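(* For every positive integer $k$, $\mathrm{Fin}_k(\mathsf{BS})\equiv_W\mathrm{Fin}_k(\mathsf{SDDCC})\equiv_W\mathrm{Fin}_k(\mathsf{DS})\equiv_W\mathsf{RT}^1_k$.
   Context: $\equiv_W$: Weihrauch equivalence. $\mathrm{Fin}_k(f)$ is the $\le_W$-maximum of the problems with codomain $\{0,\dots,k-1\}$ that are Weihrauch reducible to $f$ (it exists). $\mathsf{RT}^1_k$: given $c:\mathbb{N}\to\{0,\dots,k-1\}$, output an infinite set $H\subseteq\mathbb{N}$ on which $c$ is constant. Orders on subsets of $\mathbb{N}$ are given by the characteristic function of the relation. $\mathsf{DS}$: given an ill-founded countable linear order, output an infinite descending sequence. $\mathsf{BS}$: given a countable quasi-order that is not a well quasi-order, output an infinite bad sequence ($(q_i)$ with $q_i\not\preceq q_j$ for $i<j$). For a partial order $(P,\le_P)$, $A\subseteq P$ is dense if every $w\in P$ has some $u\ge_P w$ in $A$, and upwards-closed if $w\in A$, $w\le_P u$ imply $u\in A$. $\mathsf{SDDCC}$: given a partial order $P\subseteq\mathbb{N}$ and a dense upwards-closed subset $A\subseteq P$ given via a $\Sigma^1_1$ code (a sequence of trees $(T_n)$ on $\mathbb{N}$ with $n\in A$ iff $T_n$ has an infinite path), output an element of $A$. *)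

(* Defs.v *)
From Stdlib Require Import Arith List Lia Cantor FunctionalExtensionality.

Set Implicit Arguments.
Unset Strict Implicit.
Unset Printing Implicit Defensive.

Definition baire := nat -> nat.

(** * Computable functionals on Baire space *)

(** Programs for the partial recursive functions relative to an oracle.  All
    functions are unary; several arguments are passed through [Cantor.to_nat]. *)
Inductive code : Type :=
| Zero
| Succ
| Left
| Right
| Oracle
| Pair (c d : code)
| Comp (c d : code)
| Prec (c d : code)
| Mu (c : code).

(** [eval p c x y]: the program [c] with oracle [p] halts on [x] with output [y].
    - [Prec c d] on [(a, n)]: primitive recursion on [n], with base value [c a]
      and step [d (a, (i, v))], where [v] is the value at stage [i].
    - [Mu c] on [x]: the least [m] with [c (x, m) = 0], where [c (x, i)] must
      halt for every [i < m]. *)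
Fixpoint eval (p : baire) (c : code) : nat -> nat -> Prop :=
  match c with
  | Zero => fun _ y => y = 0
  | Succ => fun x y => y = S x
  | Left => fun x y => y = fst (of_nat x)
  | Right => fun x y => y = snd (of_nat x)
  | Oracle => fun x y => y = p x
  | Pair c d => fun x y =>
      exists u v, eval p c x u /\ eval p d x v /\ y = to_nat (u, v)
  | Comp c d => fun x y => exists z, eval p d x z /\ eval p c z y
  | Prec c d => fun x y =>
      let a := fst (of_nat x) in
      (fix stage (n : nat) (w : nat) {struct n} : Prop :=
         match n with
         | 0 => eval p c a w
         | S i => exists v, stage i v /\ eval p d (to_nat (a, to_nat (i, v))) w
         end) (snd (of_nat x)) y
  | Mu c => fun x y =>
      eval p c (to_nat (x, y)) 0 /\
      forall i, i < y -> exists v, eval p c (to_nat (x, i)) (S v)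
  end.

(** The partial functional computed by [c] is defined at [p] with value [q]. *)
Definition computes (c : code) (p q : baire) : Prop :=
  forall n, eval p c n (q n).

Definition join (p q : baire) : baire :=
  fun n => if Nat.even n then p (Nat.div2 n) else q (Nat.div2 n).

Definition evens (r : baire) : baire := fun n => r (2 * n).
Definition odds (r : baire) : baire := fun n => r (S (2 * n)).

Lemma evens_join p q : evens (join p q) = p.
Proof.
  apply functional_extensionality; intro n; unfold evens, join.
  rewrite Nat.even_even, Nat.div2_double; reflexivity.
Qed.

Lemma odds_join p q : odds (join p q) = q.
Proof.
  apply functional_extensionality; intro n; unfold odds, join.
  replace (Nat.even (S (2 * n))) with false.
  - rewrite Nat.div2_succ_double; reflexivity.
  - symmetry; rewrite <- Nat.add_1_r; apply Nat.even_odd.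
Qed.

(** * Represented spaces *)

(** A represented space: [names p x] is the graph of a partial surjection from
    Baire space onto the carrier. *)
Record repspace : Type := RepSpace {
  carrier :> Type;
  names : baire -> carrier -> Prop;
  names_fun : forall p x y, names p x -> names p y -> x = y;
  names_surj : forall x, exists p, names p x
}.

Arguments names {r} p x.

Program Definition baire_space : repspace :=
  @RepSpace baire (fun p s => forall n, p n = s n) _ _.
Next Obligation.
  apply functional_extensionality; intro n; congruence.
Qed.
Next Obligation. eauto. Qed.

Program Definition nat_space : repspace := @RepSpace nat (fun p n => p 0 = n) _ _.
Next Obligation. exists (fun _ => x); reflexivity. Qed.

Definition colour (k : nat) : Type := { i : nat | i < k }.

Lemma colour_eq k (i j : colour k) : proj1_sig i = proj1_sig j -> i = j.
Proof.
  destruct i as [i hi], j as [j hj]; simpl; intros <-.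
  f_equal; apply le_unique.
Qed.

Program Definition fin_space (k : nat) : repspace :=
  @RepSpace (colour k) (fun p i => p 0 = proj1_sig i) _ _.
Next Obligation. apply colour_eq; simpl; congruence. Qed.
Next Obligation. exists (fun _ => proj1_sig x); reflexivity. Qed.

Program Definition colouring_space (k : nat) : repspace :=
  @RepSpace (nat -> colour k) (fun p c => forall n, p n = proj1_sig (c n)) _ _.
Next Obligation.
  apply functional_extensionality; intro n; apply colour_eq; congruence.
Qed.
Next Obligation. exists (fun n => proj1_sig (x n)); reflexivity. Qed.

(** Subsets of [X], named by their characteristic functions along a bijective
    coding of [X] by natural numbers. *)
Program Definition subset_space (X : Type) (enc : X -> nat) (dec : nat -> X)
    (decK : forall x, dec (enc x) = x) (encK : forall n, enc (dec n) = n) :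
    repspace :=
  @RepSpace (X -> bool) (fun p A => forall x, p (enc x) = Nat.b2n (A x)) _ _.
Next Obligation.
  apply functional_extensionality; intro a; apply Nat.b2n_inj; congruence.
Qed.
Next Obligation.
  exists (fun n => Nat.b2n (x (dec n))); intro a; rewrite decK; reflexivity.
Qed.

Definition set_space : repspace :=
  @subset_space nat (fun n => n) (fun n => n) (fun n => eq_refl) (fun n => eq_refl).

Definition rel_space : repspace :=
  @subset_space (nat * nat) to_nat of_nat cancel_of_to cancel_to_of.

Fixpoint enc_list (s : list nat) : nat :=
  match s with
  | nil => 0
  | x :: s' => S (to_nat (x, enc_list s'))
  end.

Fixpoint dec_list_fuel (fuel n : nat) : list nat :=
  match fuel, n with
  | S f, S m => fst (of_nat m) :: dec_list_fuel f (snd (of_nat m))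
  | _, _ => nil
  end.

Definition dec_list (n : nat) : list nat := dec_list_fuel n n.

Lemma enc_dec_list_fuel f n : n <= f -> enc_list (dec_list_fuel f n) = n.
Proof.
  revert n; induction f as [|f IH]; intros [|m] Hm; try reflexivity; try lia.
  cbn [dec_list_fuel enc_list].
  pose proof (cancel_to_of m) as E.
  destruct (of_nat m) as [x y]; cbn [fst snd].
  pose proof (to_nat_non_decreasing x y).
  rewrite IH by lia; congruence.
Qed.

Lemma enc_decK n : enc_list (dec_list n) = n.
Proof. apply enc_dec_list_fuel; constructor. Qed.

Lemma enc_list_inj s t : enc_list s = enc_list t -> s = t.
Proof.
  revert t; induction s as [|x s IH]; intros [|y t] E; cbn [enc_list] in E;
    try discriminate; try reflexivity.
  apply Nat.succ_inj, to_nat_inj in E; injection E as -> E.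
  f_equal; auto.
Qed.

Lemma dec_encK s : dec_list (enc_list s) = s.
Proof. apply enc_list_inj, enc_decK. Qed.

Definition enc_node (x : nat * list nat) : nat := to_nat (fst x, enc_list (snd x)).
Definition dec_node (n : nat) : nat * list nat :=
  (fst (of_nat n), dec_list (snd (of_nat n))).

Lemma dec_enc_node x : dec_node (enc_node x) = x.
Proof.
  unfold dec_node, enc_node; rewrite cancel_of_to; cbn [fst snd].
  rewrite dec_encK; destruct x; reflexivity.
Qed.

Lemma enc_dec_node n : enc_node (dec_node n) = n.
Proof.
  unfold dec_node, enc_node; cbn [fst snd]; rewrite enc_decK.
  rewrite <- (cancel_to_of n) at 3; destruct (of_nat n); reflexivity.
Qed.

(** A sequence [(T_n)] of sets of finite sequences, as the set of all pairs
    [(n, s)] with [s] in [T_n]. *)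
Definition trees_space : repspace :=
  @subset_space (nat * list nat) enc_node dec_node dec_enc_node enc_dec_node.

Program Definition prod_space (X Y : repspace) : repspace :=
  @RepSpace (X * Y)
    (fun r z => names (evens r) (fst z) /\ names (odds r) (snd z)) _ _.
Next Obligation.
  simpl in *; f_equal; eapply names_fun; eauto.
Qed.
Next Obligation.
  destruct (names_surj c) as [p Hp], (names_surj c0) as [q Hq].
  exists (join p q); rewrite evens_join, odds_join; auto.
Qed.

(** * Problems and Weihrauch reducibility *)

(** A partial multi-valued function between represented spaces; its domain is
    the set of inputs that have at least one solution. *)
Record problem : Type := Problem {
  input : repspace;
  output : repspace;
  solution : input -> output -> Prop
}.

Arguments solution : clear implicits.

Definition dom (f : problem) (x : input f) : Prop := exists y, solution f x y.

Arguments dom : clear implicits.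

Definition weihrauch_le (f g : problem) : Prop :=
  exists Phi Psi : code,
    forall (p : baire) (x : input f), names p x -> dom f x ->
      exists (q : baire) (u : input g),
        computes Phi p q /\ names q u /\ dom g u /\
        forall (r : baire) (v : output g), names r v -> solution g u v ->
          exists (s : baire) (y : output f),
            computes Psi (join p r) s /\ names s y /\ solution f x y.

Definition weihrauch_eq (f g : problem) : Prop :=
  weihrauch_le f g /\ weihrauch_le g f.

Notation "f <=W g" := (weihrauch_le f g) (at level 70, no associativity).
Notation "f =W g" := (weihrauch_eq f g) (at level 70, no associativity).

Record fin_problem (k : nat) : Type := FinProblem {
  fin_input : repspace;
  fin_solution : fin_input -> fin_space k -> Prop
}.

Definition problem_of_fin (k : nat) (F : fin_problem k) : problem :=
  Problem (@fin_solution k F).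

Coercion problem_of_fin : fin_problem >-> problem.

(** [Fin_k f] is only determined up to Weihrauch equivalence, so it is given by
    the predicate "[F] is a representative of [Fin_k f]". *)
Definition is_Fin (k : nat) (f : problem) (F : fin_problem k) : Prop :=
  F <=W f /\ forall G : fin_problem k, G <=W f -> G <=W F.

(** * The problems *)

Definition infinite (H : nat -> bool) : Prop :=
  forall m, exists n, m <= n /\ H n = true.

Definition RT1 (k : nat) : problem :=
  @Problem (colouring_space k) set_space
    (fun c H => infinite H /\ exists i, forall n, H n = true -> c n = i).

(** A quasi-order on a subset of [nat] is given by its relation alone; the
    underlying set is then the set of [x] with [R (x, x) = true]. *)
Definition underlying (R : nat * nat -> bool) (x : nat) : Prop := R (x, x) = true.

Definition quasi_order (R : nat * nat -> bool) : Prop :=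
  (forall x y, R (x, y) = true -> underlying R x /\ underlying R y) /\
  (forall x y z, R (x, y) = true -> R (y, z) = true -> R (x, z) = true).

Definition partial_order (R : nat * nat -> bool) : Prop :=
  quasi_order R /\
  (forall x y, R (x, y) = true -> R (y, x) = true -> x = y).

Definition linear_order (R : nat * nat -> bool) : Prop :=
  partial_order R /\
  (forall x y, underlying R x -> underlying R y -> R (x, y) = true \/ R (y, x) = true).

Definition descending (R : nat * nat -> bool) (s : nat -> nat) : Prop :=
  forall i, R (s (S i), s i) = true /\ s (S i) <> s i.

Definition ill_founded (R : nat * nat -> bool) : Prop :=
  exists s, descending R s.

Definition DS : problem :=
  @Problem rel_space baire_space
    (fun R s => linear_order R /\ ill_founded R /\ descending R s).

Definition well_quasi_order (R : nat * nat -> bool) : Prop :=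
  quasi_order R /\
  forall s : nat -> nat, (forall i, underlying R (s i)) ->
    exists i j, i < j /\ R (s i, s j) = true.

Definition bad (R : nat * nat -> bool) (s : nat -> nat) : Prop :=
  (forall i, underlying R (s i)) /\ (forall i j, i < j -> R (s i, s j) = false).

Definition BS : problem :=
  @Problem rel_space baire_space
    (fun R s => quasi_order R /\ ~ well_quasi_order R /\ bad R s).

Definition is_tree (T : list nat -> bool) : Prop :=
  forall s t, T (s ++ t) = true -> T s = true.

Definition has_path (T : list nat -> bool) : Prop :=
  exists g : nat -> nat, forall n, T (map g (seq 0 n)) = true.

Definition coded (T : nat * list nat -> bool) (n : nat) : Prop :=
  has_path (fun s => T (n, s)).

Definition dense (R : nat * nat -> bool) (A : nat -> Prop) : Prop :=
  forall w, underlying R w -> exists u, R (w, u) = true /\ A u.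

Definition upwards_closed (R : nat * nat -> bool) (A : nat -> Prop) : Prop :=
  forall w u, A w -> R (w, u) = true -> A u.

Definition SDDCC : problem :=
  @Problem (prod_space rel_space trees_space) nat_space
    (fun I a =>
       let R := fst I in
       let T := snd I in
       partial_order R /\
       (forall n, is_tree (fun s => T (n, s))) /\
       (forall n, coded T n -> underlying R n) /\
       dense R (coded T) /\
       upwards_closed R (coded T) /\
       coded T a).

(* Main.v *)
Require Import Defs.
From Stdlib Require Import Arith List Lia Bool Cantor Classical ConstructiveEpsilon Wf_nat.

(** [RT1 k] is equivalent to the finite problem [crt k]: name a colour that
    occurs infinitely often.

    Suppose that a finite problem reduces to [BS].  The candidates are the finite
    bad sequences on which the backward functional answers, ordered by reverse
    inclusion of their upward closures.  The ones that extend to an infinite bad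
    sequence form an upwards closed set, which is also dense: an infinite bad
    sequence that cannot be appended to [f], not even after deleting finitely
    many terms, meets the upward closure of [f] infinitely often, hence has a
    subsequence inside it.  For [SDDCC] density is given.  Above any candidate
    there is thus one above which only valid colours occur.  Call a set of
    colours avoidable if some candidate has none of them above it; adding an
    invalid colour keeps a set avoidable, so that all members of a minimal
    unavoidable set are valid.  The least candidate not yet seen to fail for a
    set stabilizes exactly for avoidable sets, so comparing these indices finds
    minimal unavoidable sets in the limit, and gives a colouring that takes only
    valid values from some point on.

    Conversely, from a colouring call [n] good if every colour used from [n] on
    is used infinitely often.  Goodness is upwards closed and eventually true,
    which gives an instance of [SDDCC].  Replacing each [n] by a reversed copy of
    [omega] if [n] is good, and by a finite order otherwise, gives an instance of
    [DS] whose descending sequences start at a good [n]. *)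

(** * Computable functionals *)

Definition pr (a b : nat) : nat := to_nat (a, b).
Definition pi1 (n : nat) : nat := fst (of_nat n).
Definition pi2 (n : nat) : nat := snd (of_nat n).

Lemma pi1_pr a b : pi1 (pr a b) = a.
Proof. unfold pi1, pr; rewrite cancel_of_to; reflexivity. Qed.

Lemma pi2_pr a b : pi2 (pr a b) = b.
Proof. unfold pi2, pr; rewrite cancel_of_to; reflexivity. Qed.

Lemma pr_pi n : pr (pi1 n) (pi2 n) = n.
Proof. unfold pi1, pi2, pr; rewrite <- surjective_pairing; apply cancel_to_of. Qed.

Lemma pr_surj n : exists a b, n = pr a b.
Proof. exists (pi1 n), (pi2 n); symmetry; apply pr_pi. Qed.

(** These two unfolding rules hide the local fixpoint in [eval] from all later inductions on
    [Prec]. *)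
Lemma eval_prec_0 p c d a y : eval p (Prec c d) (pr a 0) y <-> eval p c a y.
Proof. cbn [eval]; unfold pr; rewrite cancel_of_to; reflexivity. Qed.

Lemma eval_prec_S p c d a n y :
  eval p (Prec c d) (pr a (S n)) y <->
  exists v, eval p (Prec c d) (pr a n) v /\ eval p d (pr a (pr n v)) y.
Proof. cbn [eval]; unfold pr; rewrite !cancel_of_to; reflexivity. Qed.

(** Determinism later identifies the answer of a bounded run on a finite prefix with the output on a
    full name. *)
Lemma eval_fun p c x y z : eval p c x y -> eval p c x z -> y = z.
Proof.
  revert x y z; induction c as [| | | | |c IHc d IHd|c IHc d IHd|c IHc d IHd|c IHc];
    intros x y z; try (cbn [eval]; congruence).
  - intros (u & v & Hu & Hv & ->) (u' & v' & Hu' & Hv' & ->).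
    now rewrite (IHc _ _ _ Hu Hu'), (IHd _ _ _ Hv Hv').
  - intros (u & Hu & Hy) (v & Hv & Hz).
    rewrite (IHd _ _ _ Hu Hv) in Hy; eauto.
  - destruct (pr_surj x) as (a & n & ->); revert y z.
    induction n as [|n IHn]; intros y z.
    + rewrite !eval_prec_0; eauto.
    + rewrite !eval_prec_S; intros (u & Hu & Hy) (v & Hv & Hz).
      rewrite (IHn _ _ Hu Hv) in Hy; eauto.
  - intros [Hy Hy'] [Hz Hz'].
    destruct (lt_eq_lt_dec y z) as [[H| ->]|H]; [|reflexivity|].
    + destruct (Hz' _ H) as [v Hv]; discriminate (IHc _ _ _ Hy Hv).
    + destruct (Hy' _ H) as [v Hv]; discriminate (IHc _ _ _ Hz Hv).
Qed.

(** [psubst] carries its parameter in front, while [Prec] and [Mu] append their loop data at the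
    back; this program converts between the two nestings. *)
Definition reassoc : code := Pair (Comp Left Left) (Pair (Comp Right Left) Right).

Lemma eval_left p a b : eval p Left (pr a b) a.
Proof. symmetry; apply pi1_pr. Qed.

Lemma eval_right p a b : eval p Right (pr a b) b.
Proof. symmetry; apply pi2_pr. Qed.

Lemma eval_reassoc p a b c : eval p reassoc (pr (pr a b) c) (pr a (pr b c)).
Proof.
  assert (H : eval p Left (pr (pr a b) c) (pr a b)) by apply eval_left.
  exists a, (pr b c); repeat split.
  - exists (pr a b); split; [exact H|apply eval_left].
  - exists b, c; repeat split; [|apply eval_right].
    exists (pr a b); split; [exact H|apply eval_right].
Qed.

(** [psubst d c] on [(a, x)] runs [c] on [x], answering each oracle query [n]
    by running [d] on [(a, n)]. *)
Fixpoint psubst (d c : code) : code :=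
  match c with
  | Zero => Zero
  | Succ => Comp Succ Right
  | Left => Comp Left Right
  | Right => Comp Right Right
  | Oracle => d
  | Pair c1 c2 => Pair (psubst d c1) (psubst d c2)
  | Comp c1 c2 => Comp (psubst d c1) (Pair Left (psubst d c2))
  | Prec c1 c2 =>
      Comp (Prec (psubst d c1) (Comp (psubst d c2) reassoc))
        (Pair (Pair Left (Comp Left Right)) (Comp Right Right))
  | Mu c1 => Mu (Comp (psubst d c1) reassoc)
  end.

Lemma eval_psubst p d q a c x y :
  (forall n, eval p d (pr a n) (q n)) -> eval q c x y ->
  eval p (psubst d c) (pr a x) y.
Proof.
  intros Hd; revert x y.
  assert (HL := eval_left p a).
  assert (HR := eval_right p a).
  induction c as [| | | | |c IHc e IHe|c IHc e IHe|c IHc e IHe|c IHc];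
    intros x y; cbn [psubst].
  - auto.
  - intros ->; exists x; split; [apply eval_right|reflexivity].
  - intros ->; exists x; split; [apply eval_right|reflexivity].
  - intros ->; exists x; split; [apply eval_right|reflexivity].
  - intros ->; apply Hd.
  - intros (u & v & Hu & Hv & ->); exists u, v; auto.
  - intros (u & Hu & Hy); exists (pr a u); split; [|auto].
    exists a, u; auto.
  - destruct (pr_surj x) as (b & n & ->); intro H; exists (pr (pr a b) n); split.
    + exists (pr a b), n; repeat split.
      * exists a, b; repeat split; auto.
        exists (pr b n); split; [auto|symmetry; apply pi1_pr].
      * exists (pr b n); split; [auto|symmetry; apply pi2_pr].
    + revert y H; induction n as [|n IHn]; intro y.
      * rewrite !eval_prec_0; auto.
      * rewrite !eval_prec_S; intros (v & Hv & Hy); exists v; split; [auto|].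
        exists (pr a (pr b (pr n v))); auto using eval_reassoc.
  - intros [Hy Hlt]; split.
    + exists (pr a (pr x y)); split; [apply eval_reassoc|apply IHc, Hy].
    + intros i Hi; destruct (Hlt i Hi) as [v Hv]; exists v.
      exists (pr a (pr x i)); split; [apply eval_reassoc|apply IHc, Hv].
Qed.

Definition ident : code := Pair Left Right.

Lemma eval_ident p x : eval p ident x x.
Proof. exists (pi1 x), (pi2 x); repeat split; symmetry; apply pr_pi. Qed.

(** Oracle substitution without a parameter: the slot is filled with 0, and [Comp d Right] discards
    it. *)
Definition subst (d c : code) : code :=
  Comp (psubst (Comp d Right) c) (Pair Zero ident).

Lemma eval_subst p q d c x y :
  computes d p q -> eval q c x y -> eval p (subst d c) x y.
Proof.
  intros Hd Hc; exists (pr 0 x); split.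
  - exists 0, x; repeat split; apply eval_ident.
  - apply eval_psubst with (q := q); [|exact Hc].
    intro n; exists n; split; [symmetry; apply pi2_pr|apply Hd].
Qed.

Lemma computes_subst p q r d c :
  computes d p q -> computes c q r -> computes (subst d c) p r.
Proof. intros Hd Hc n; apply eval_subst with (1 := Hd), Hc. Qed.

(** * Closure properties of total computable functionals *)

Definition computable (F : baire -> nat -> nat) : Prop :=
  exists c, forall p, computes c p (F p).

Lemma computable_ext F G :
  (forall p x, F p x = G p x) -> computable F -> computable G.
Proof.
  intros E [c Hc]; exists c; intros p x; rewrite <- E; apply Hc.
Qed.

Lemma computable_id : computable (fun _ x => x).
Proof. exists ident; intros p x; apply eval_ident. Qed.

Lemma computable_S F : computable F -> computable (fun p x => S (F p x)).
Proof.
  intros [c Hc]; exists (Comp Succ c);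
  intros p x; exists (F p x); split; [apply Hc|reflexivity].
Qed.

Lemma computable_const n : computable (fun _ _ => n).
Proof.
  induction n as [|n IH]; [exists Zero; intros p x; reflexivity|].
  exact (computable_S _ IH).
Qed.

Lemma computable_oracle F : computable F -> computable (fun p x => p (F p x)).
Proof.
  intros [c Hc]; exists (Comp Oracle c);
  intros p x; exists (F p x); split; [apply Hc|reflexivity].
Qed.

Lemma computable_pi1 F : computable F -> computable (fun p x => pi1 (F p x)).
Proof.
  intros [c Hc]; exists (Comp Left c);
  intros p x; exists (F p x); split; [apply Hc|reflexivity].
Qed.

Lemma computable_pi2 F : computable F -> computable (fun p x => pi2 (F p x)).
Proof.
  intros [c Hc]; exists (Comp Right c);
  intros p x; exists (F p x); split; [apply Hc|reflexivity].
Qed.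

Lemma computable_pr F G :
  computable F -> computable G -> computable (fun p x => pr (F p x) (G p x)).
Proof.
  intros [c Hc] [d Hd]; exists (Pair c d); intros p x.
  exists (F p x), (G p x); repeat split; [apply Hc|apply Hd].
Qed.

Lemma computable_comp F G :
  computable F -> computable G -> computable (fun p x => F p (G p x)).
Proof.
  intros [c Hc] [d Hd]; exists (Comp c d); intros p x.
  exists (G p x); split; [apply Hd|apply Hc].
Qed.

Lemma computable_comp2 (H : baire -> nat -> nat -> nat) F G :
  computable (fun p z => H p (pi1 z) (pi2 z)) ->
  computable F -> computable G -> computable (fun p x => H p (F p x) (G p x)).
Proof.
  intros HH HF HG.
  apply computable_ext with (2 := computable_comp _ _ HH (computable_pr _ _ HF HG)).
  intros p x; cbn beta; rewrite pi1_pr, pi2_pr; reflexivity.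
Qed.

Lemma computable_rec A (B : baire -> nat -> nat -> nat -> nat) N :
  computable A ->
  computable (fun p z => B p (pi1 z) (pi1 (pi2 z)) (pi2 (pi2 z))) ->
  computable N ->
  computable (fun p x => nat_rect (fun _ => nat) (A p x) (B p x) (N p x)).
Proof.
  intros [a Ha] [b Hb] [n Hn]; exists (Comp (Prec a b) (Pair ident n)); intros p x.
  exists (pr x (N p x)); split.
  - exists x, (N p x); repeat split; [apply eval_ident|apply Hn].
  - induction (N p x) as [|m IH].
    + apply eval_prec_0, Ha.
    + apply eval_prec_S; eexists; split; [apply IH|].
      specialize (Hb p (pr x (pr m (nat_rect (fun _ => nat) (A p x) (B p x) m)))).
      cbn beta in Hb; rewrite !pi2_pr, !pi1_pr in Hb; exact Hb.
Qed.

(** The inner oracle may vary with [x], which serves as the parameter of [psubst]. This allows one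
    program to simulate [Psi] on a different finite prefix for each candidate. *)
Lemma computable_oracle_subst F (D : baire -> nat -> nat -> nat) N :
  computable F -> computable (fun p z => D p (pi1 z) (pi2 z)) -> computable N ->
  computable (fun p x => F (fun n => D p x n) (N p x)).
Proof.
  intros [c Hc] [d Hd] [n Hn]; exists (Comp (psubst d c) (Pair ident n)); intros p x.
  exists (pr x (N p x)); split.
  - exists x, (N p x); repeat split; [apply eval_ident|apply Hn].
  - apply eval_psubst with (q := D p x); [|apply Hc].
    intro m; specialize (Hd p (pr x m)); cbn beta in Hd.
    rewrite pi1_pr, pi2_pr in Hd; exact Hd.
Qed.

Lemma computable_if b F G :
  computable (fun p x => Nat.b2n (b p x)) -> computable F -> computable G ->
  computable (fun p x => if b p x then F p x else G p x).
Proof.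
  intros Hb HF HG.
  (* A case distinction is a recursion of length 0 or 1, with base value [G] and step value [F]. *)
  apply computable_ext with (F := fun p x =>
    nat_rect (fun _ => nat) (G p x) (fun _ _ => F p x) (Nat.b2n (b p x))).
  - intros p x; destruct (b p x); reflexivity.
  - apply computable_rec; auto.
    apply computable_comp with (1 := HF), computable_pi1, computable_id.
Qed.

Lemma computable_pred F : computable F -> computable (fun p x => Nat.pred (F p x)).
Proof.
  intro HF.
  apply computable_ext with (F := fun p x =>
    nat_rect (fun _ => nat) 0 (fun i _ => i) (F p x)).
  - intros p x; destruct (F p x); reflexivity.
  - apply computable_rec; auto using computable_const, computable_pi1, computable_pi2, computable_id.
Qed.

Lemma computable_sub F G :
  computable F -> computable G -> computable (fun p x => F p x - G p x).
Proof.
  intros HF HG.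
  apply computable_ext with (F := fun p x =>
    nat_rect (fun _ => nat) (F p x) (fun _ v => Nat.pred v) (G p x)).
  - intros p x; induction (G p x) as [|n IH]; cbn [nat_rect]; lia.
  - apply computable_rec; auto using computable_pred, computable_pi2, computable_id.
Qed.

Lemma computable_eq0 F :
  computable F -> computable (fun p x => Nat.b2n (F p x =? 0)).
Proof.
  intro HF; apply computable_ext with (F := fun p x => 1 - F p x).
  - intros p x; destruct (F p x) as [|[|]]; reflexivity.
  - auto using computable_sub, computable_const.
Qed.

Lemma computable_negb b :
  computable (fun p x => Nat.b2n (b p x)) ->
  computable (fun p x => Nat.b2n (negb (b p x))).
Proof.
  intro Hb; apply computable_ext with (F := fun p x => 1 - Nat.b2n (b p x)).
  - intros p x; destruct (b p x); reflexivity.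
  - auto using computable_sub, computable_const.
Qed.

Lemma computable_true : computable (fun _ _ => Nat.b2n true).
Proof. apply computable_const. Qed.

Lemma computable_false : computable (fun _ _ => Nat.b2n false).
Proof. apply computable_const. Qed.

Lemma computable_ifb b c d :
  computable (fun p x => Nat.b2n (b p x)) -> computable (fun p x => Nat.b2n (c p x)) ->
  computable (fun p x => Nat.b2n (d p x)) ->
  computable (fun p x => Nat.b2n (if b p x then c p x else d p x)).
Proof.
  intros Hb Hc Hd.
  apply computable_ext with (2 := computable_if _ _ _ Hb Hc Hd).
  intros p x; destruct (b p x); reflexivity.
Qed.

Lemma computable_andb b c :
  computable (fun p x => Nat.b2n (b p x)) -> computable (fun p x => Nat.b2n (c p x)) ->
  computable (fun p x => Nat.b2n (b p x && c p x)).
Proof. intros Hb Hc; apply computable_ifb; auto using computable_false. Qed.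

Lemma computable_orb b c :
  computable (fun p x => Nat.b2n (b p x)) -> computable (fun p x => Nat.b2n (c p x)) ->
  computable (fun p x => Nat.b2n (b p x || c p x)).
Proof. intros Hb Hc; apply computable_ifb; auto using computable_true. Qed.

Lemma computable_leb F G :
  computable F -> computable G -> computable (fun p x => Nat.b2n (F p x <=? G p x)).
Proof.
  intros HF HG; apply computable_ext with (F := fun p x => Nat.b2n (F p x - G p x =? 0)).
  - intros p x; f_equal.
    destruct (Nat.leb_spec (F p x) (G p x)); [apply Nat.eqb_eq|apply Nat.eqb_neq]; lia.
  - auto using computable_eq0, computable_sub.
Qed.

Lemma computable_ltb F G :
  computable F -> computable G -> computable (fun p x => Nat.b2n (F p x <? G p x)).
Proof. intros; apply computable_leb; auto using computable_S. Qed.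

Lemma computable_eqb F G :
  computable F -> computable G -> computable (fun p x => Nat.b2n (F p x =? G p x)).
Proof.
  intros HF HG.
  apply computable_ext with (F := fun p x =>
    Nat.b2n ((F p x <=? G p x) && (G p x <=? F p x))).
  - intros p x; f_equal; destruct (Nat.eqb_spec (F p x) (G p x)) as [->|H].
    + now rewrite Nat.leb_refl.
    + apply andb_false_iff; rewrite !Nat.leb_gt; lia.
  - auto using computable_andb, computable_leb.
Qed.

Lemma computable_forallb (b : baire -> nat -> nat -> bool) N :
  computable N -> computable (fun p z => Nat.b2n (b p (pi1 z) (pi2 z))) ->
  computable (fun p x => Nat.b2n (forallb (fun i => b p x i) (seq 0 (N p x)))).
Proof.
  intros HN Hb.
  apply computable_ext with (F := fun p x =>
    nat_rect (fun _ => nat) 1 (fun i v => if b p x i then v else 0) (N p x)).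
  - intros p x; induction (N p x) as [|n IH]; [reflexivity|].
    rewrite seq_S, forallb_app; cbn [nat_rect forallb plus]; rewrite IH, andb_true_r.
    destruct (b p x n), forallb; reflexivity.
  - apply computable_rec; auto using computable_const.
    apply computable_if; auto using computable_const, computable_pi2, computable_id.
    exact (computable_comp2 (fun p x i => Nat.b2n (b p x i)) _ _ Hb
      (computable_pi1 _ computable_id) (computable_pi1 _ (computable_pi2 _ computable_id))).
Qed.

Lemma computable_existsb (b : baire -> nat -> nat -> bool) N :
  computable N -> computable (fun p z => Nat.b2n (b p (pi1 z) (pi2 z))) ->
  computable (fun p x => Nat.b2n (existsb (fun i => b p x i) (seq 0 (N p x)))).
Proof.
  intros HN Hb.
  apply computable_ext with (F := fun p x =>
    Nat.b2n (negb (forallb (fun i => negb (b p x i)) (seq 0 (N p x))))).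
  - intros p x; f_equal; induction (seq 0 (N p x)) as [|i l IH]; [reflexivity|].
    cbn [forallb existsb]; rewrite negb_andb, negb_involutive, IH; reflexivity.
  - apply computable_negb, computable_forallb; [exact HN|].
    exact (computable_negb (fun p z => b p (pi1 z) (pi2 z)) Hb).
Qed.

(** The least [i < n] with [f i = true], or [n] if there is none. *)
Fixpoint least (n : nat) (f : nat -> bool) : nat :=
  match n with
  | 0 => 0
  | S m => if least m f <? m then least m f else if f m then m else n
  end.

Lemma least_spec n f :
  least n f <= n /\ (forall i, i < least n f -> f i = false) /\
  (least n f < n -> f (least n f) = true).
Proof.
  induction n as [|n (Hle & Hlt & Hf)]; [repeat split; cbn; intros; lia|].
  cbn [least]; destruct (Nat.ltb_spec (least n f) n) as [H|H].
  - repeat split; auto; lia.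
  - replace (least n f) with n in Hlt by lia.
    destruct (f n) eqn:E; repeat split; auto; try lia.
    intros i Hi; destruct (Nat.eq_dec i n) as [->|]; [exact E|apply Hlt; lia].
Qed.

Lemma computable_least (b : baire -> nat -> nat -> bool) N :
  computable N -> computable (fun p z => Nat.b2n (b p (pi1 z) (pi2 z))) ->
  computable (fun p x => least (N p x) (fun i => b p x i)).
Proof.
  intros HN Hb.
  apply computable_ext with (F := fun p x =>
    nat_rect (fun _ => nat) 0
      (fun i v => if v <? i then v else if b p x i then i else S i) (N p x)).
  - intros p x; induction (N p x) as [|n IH]; [reflexivity|].
    cbn [nat_rect least]; rewrite IH; reflexivity.
  - assert (H1 := computable_pi1 _ (computable_pi2 _ computable_id)).
    apply computable_rec; auto using computable_const.
    apply computable_if; auto using computable_ltb, computable_pi2, computable_id.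
    apply computable_if; auto using computable_S.
    exact (computable_comp2 (fun p x i => Nat.b2n (b p x i)) _ _ Hb
      (computable_pi1 _ computable_id) H1).
Qed.

Lemma computable_even F :
  computable F -> computable (fun p x => Nat.b2n (Nat.even (F p x))).
Proof.
  intro HF; apply computable_ext with (F := fun p x =>
    nat_rect (fun _ => nat) 1 (fun _ v => 1 - v) (F p x)).
  - intros p x; induction (F p x) as [|n IH]; [reflexivity|].
    cbn [nat_rect]; rewrite IH, Nat.even_succ, <- Nat.negb_even.
    destruct (Nat.even n); reflexivity.
  - apply computable_rec; auto using computable_const, computable_sub, computable_pi2, computable_id.
Qed.

Lemma computable_div2 F : computable F -> computable (fun p x => Nat.div2 (F p x)).
Proof.
  intro HF; apply computable_ext with (F := fun p x =>
    nat_rect (fun _ => nat) 0 (fun i v => if Nat.even i then v else S v) (F p x)).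
  - intros p x; induction (F p x) as [|n IH]; [reflexivity|].
    cbn [nat_rect]; rewrite IH.
    destruct (Nat.even n) eqn:E.
    + apply Nat.even_spec in E; destruct E as [m ->].
      now rewrite Nat.div2_double, Nat.div2_succ_double.
    + rewrite <- Nat.negb_odd in E; apply negb_false_iff, Nat.odd_spec in E.
      destruct E as [m ->]; rewrite Nat.add_1_r, Nat.div2_succ_double.
      replace (S (S (2 * m))) with (2 * S m) by lia; now rewrite Nat.div2_double.
  - apply computable_rec; auto using computable_const.
    apply computable_if; auto using computable_even, computable_S, computable_pi1, computable_pi2, computable_id.
Qed.

Lemma computable_double F : computable F -> computable (fun p x => 2 * F p x).
Proof.
  intro HF; apply computable_ext with (F := fun p x =>
    nat_rect (fun _ => nat) 0 (fun _ v => S (S v)) (F p x)).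
  - intros p x; induction (F p x) as [|n IH]; cbn [nat_rect]; lia.
  - apply computable_rec; auto using computable_const, computable_S, computable_pi2, computable_id.
Qed.

Lemma computable_evens F : computable F -> computable (fun p x => evens p (F p x)).
Proof. intro; apply computable_oracle; auto using computable_double. Qed.

Lemma computable_odds F : computable F -> computable (fun p x => odds p (F p x)).
Proof. intro; apply computable_oracle; auto using computable_double, computable_S. Qed.

Ltac computable := repeat first
  [ assumption
  | simple apply computable_const | simple apply computable_id
  | simple apply computable_pi1 | simple apply computable_pi2 | simple apply computable_pr
  | simple apply computable_evens | simple apply computable_odds
  | simple apply computable_oracle
  | simple apply computable_S | simple apply computable_pred | simple apply computable_sub
  | simple apply computable_div2
  | simple apply computable_eq0 | simple apply computable_negb
  | simple apply computable_andb | simple apply computable_orb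
  | simple apply computable_leb | simple apply computable_ltb | simple apply computable_eqb
  | simple apply computable_forallb | simple apply computable_existsb
  | simple apply computable_least | simple apply computable_even
  | simple apply computable_if | simple apply computable_rec ].

(** * Joins of programs and composition of reductions *)

Lemma computes_join a b : exists c, forall p q r,
  computes a p q -> computes b p r -> computes c p (join q r).
Proof.
  assert (HJ : computable (fun _ x =>
    if Nat.even (pi1 x) then pi1 (pi2 x) else pi2 (pi2 x))) by computable.
  assert (HD : computable (fun _ x => Nat.div2 x)) by computable.
  destruct HJ as [cj Hj], HD as [cd Hd].
  (* Both programs run on half of [n] and parity selects the answer; running both is harmless
     because [q] and [r] are total. *)
  exists (Comp cj (Pair ident (Pair (Comp a cd) (Comp b cd)))); intros p q r Ha Hb n.
  exists (pr n (pr (q (Nat.div2 n)) (r (Nat.div2 n)))); split.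
  - exists n, (pr (q (Nat.div2 n)) (r (Nat.div2 n))); repeat split; [apply eval_ident|].
    exists (q (Nat.div2 n)), (r (Nat.div2 n)); repeat split; eexists; split;
      (apply Hd || apply Ha || apply Hb).
  - specialize (Hj p (pr n (pr (q (Nat.div2 n)) (r (Nat.div2 n))))); cbn beta in Hj.
    rewrite !pi2_pr, !pi1_pr in Hj; exact Hj.
Qed.

Lemma weihrauch_le_trans f g h : f <=W g -> g <=W h -> f <=W h.
Proof.
  intros (P1 & Q1 & H1) (P2 & Q2 & H2).
  assert (HE : computable (fun p x => evens p x)) by computable.
  assert (HO : computable (fun p x => odds p x)) by computable.
  destruct HE as [ce He], HO as [co Ho].
  (* From [join p r], the program [c1] rebuilds the inner oracle [join q r], and [c2] then builds
     the outer oracle [join p s]. *)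
  destruct (computes_join (subst ce P1) co) as [c1 Hc1].
  destruct (computes_join ce (subst c1 Q2)) as [c2 Hc2].
  exists (subst P1 P2), (subst c2 Q1); intros p x Hp Hx.
  destruct (H1 p x Hp Hx) as (q & u & Hq & Hu & Du & K1).
  destruct (H2 q u Hu Du) as (q2 & u2 & Hq2 & Hu2 & Du2 & K2).
  exists q2, u2; repeat split; auto; [eapply computes_subst; eauto|].
  intros r v Hr Hv; destruct (K2 r v Hr Hv) as (s & y & Hs & Hy & Sy).
  destruct (K1 s y Hy Sy) as (s' & y' & Hs' & Hy' & Sy').
  exists s', y'; repeat split; auto.
  assert (E1 : computes ce (join p r) p).
  { specialize (He (join p r)); cbn beta in He; intro n.
    specialize (He n); rewrite evens_join in He; exact He. }
  assert (E2 : computes co (join p r) r).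
  { intro n; specialize (Ho (join p r) n); cbn beta in Ho; rewrite odds_join in Ho; exact Ho. }
  apply computes_subst with (join p s); [|exact Hs'].
  apply Hc2; [exact E1|].
  apply computes_subst with (join q r); [|exact Hs].
  apply Hc1; [|exact E2].
  apply computes_subst with p; assumption.
Qed.

(** * Bounded evaluation with a partial oracle *)

(** Evaluation of [c] with an oracle [o] that may be partial and with all [Mu]
    searches bounded by [t]: [0] means "no answer", [S y] the answer [y], both
    for the oracle and for the result. *)
Fixpoint run (c : code) (o : baire) (t x : nat) : nat :=
  match c with
  | Zero => 1
  | Succ => S (S x)
  | Left => S (pi1 x)
  | Right => S (pi2 x)
  | Oracle => o x
  | Pair c d =>
      if run c o t x =? 0 then 0
      else if run d o t x =? 0 then 0
      else S (pr (Nat.pred (run c o t x)) (Nat.pred (run d o t x)))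
  | Comp c d =>
      if run d o t x =? 0 then 0 else run c o t (Nat.pred (run d o t x))
  | Prec c d =>
      nat_rect (fun _ => nat) (run c o t (pi1 x))
        (fun i v => if v =? 0 then 0
                    else run d o t (pr (pi1 x) (pr i (Nat.pred v))))
        (pi2 x)
  | Mu c =>
      let m := least t (fun i => run c o t (pr x i) <=? 1) in
      if run c o t (pr x m) =? 1 then S m else 0
  end.

Lemma computable_run_code c : computable (fun o z => run c o (pi1 z) (pi2 z)).
Proof.
  assert (app : forall e F G,
    computable (fun o z => run e o (pi1 z) (pi2 z)) -> computable F -> computable G ->
    computable (fun o z => run e o (F o z) (G o z))).
  { intros e F G; apply computable_comp2 with (H := run e). }
  induction c as [| | | | |c IHc d IHd|c IHc d IHd|c IHc d IHd|c IHc]; cbn [run];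
    repeat first [progress computable | simple apply app].
Qed.

Lemma computable_run c (D : baire -> nat -> nat -> nat) T X :
  computable (fun p z => D p (pi1 z) (pi2 z)) -> computable T -> computable X ->
  computable (fun p x => run c (fun n => D p x n) (T p x) (X p x)).
Proof.
  intros HD HT HX.
  apply computable_ext with (2 := computable_oracle_subst _ D _
    (computable_run_code c) HD (computable_pr _ _ HT HX)).
  intros p x; cbn beta; rewrite pi1_pr, pi2_pr; reflexivity.
Qed.

Lemma run_sound r o t c x y :
  (forall n v, o n = S v -> r n = v) -> run c o t x = S y -> eval r c x y.
Proof.
  intros Ho; revert x y.
  induction c as [| | | | |c IHc d IHd|c IHc d IHd|c IHc d IHd|c IHc];
    intros x y; cbn [run].
  - cbn; congruence.
  - cbn; congruence.
  - cbn; unfold pi1; congruence.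
  - cbn; unfold pi2; congruence.
  - intro E; symmetry; apply Ho, E.
  - destruct (run c o t x) as [|u] eqn:Eu; [discriminate|].
    destruct (run d o t x) as [|v] eqn:Ev; [discriminate|].
    intro E; injection E as <-; exists u, v; auto.
  - destruct (run d o t x) as [|z] eqn:Ez; [discriminate|].
    intro E; exists z; auto.
  - destruct (pr_surj x) as (a & n & ->); rewrite pi1_pr, pi2_pr.
    revert y; induction n as [|n IHn]; intro y; cbn [nat_rect].
    + rewrite eval_prec_0; auto.
    + destruct nat_rect as [|v] eqn:Ev; [discriminate|].
      intro E; apply eval_prec_S; exists v; split; [apply IHn; reflexivity|apply IHd, E].
  (* The test [<=? 1] stops at a missing answer as well as at the answer 0, so every value before
     [m] is a genuine nonzero answer. *)
  - destruct (least_spec t (fun i => run c o t (pr x i) <=? 1)) as (_ & Hlt & _).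
    set (m := least _ _) in *.
    destruct (Nat.eqb_spec (run c o t (pr x m)) 1) as [E|]; [|discriminate].
    intro Ey; injection Ey as <-; split; [apply IHc, E|].
    intros i Hi; specialize (Hlt i Hi); apply Nat.leb_gt in Hlt.
    destruct (run c o t (pr x i)) as [|[|v]] eqn:Ei; try lia.
    exists v; apply IHc, Ei.
Qed.

Lemma uniform_bound (P : nat -> nat -> Prop) n :
  (forall i N M, P i N -> N <= M -> P i M) ->
  (forall i, i < n -> exists N, P i N) -> exists N, forall i, i < n -> P i N.
Proof.
  intros mono; induction n as [|n IH]; intro H; [exists 0; intros; lia|].
  destruct IH as [N HN]; [intros; apply H; lia|].
  destruct (H n (Nat.lt_succ_diag_r n)) as [M HM].
  exists (N + M); intros i Hi; destruct (Nat.eq_dec i n) as [->|].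
  - apply mono with M; [exact HM|lia].
  - apply mono with N; [apply HN|]; lia.
Qed.

(** Use principle: a halting computation asks finitely many oracle queries and makes finitely many
    bounded searches, so one [N] dominates them all. *)
Lemma run_complete r c x y :
  eval r c x y -> exists N, forall t o,
    N <= t -> (forall n, n < N -> o n = S (r n)) -> run c o t x = S y.
Proof.
  revert x y.
  induction c as [| | | | |c IHc d IHd|c IHc d IHd|c IHc d IHd|c IHc];
    intros x y; cbn [run].
  - intros ->; exists 0; reflexivity.
  - intros ->; exists 0; reflexivity.
  - intros ->; exists 0; reflexivity.
  - intros ->; exists 0; reflexivity.
  - intros ->; exists (S x); auto.
  - intros (u & v & Hu & Hv & ->).
    destruct (IHc _ _ Hu) as [N HN], (IHd _ _ Hv) as [M HM]; exists (N + M); intros t o Ht Ho.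
    rewrite (HN t o); [|lia|intros; apply Ho; lia].
    rewrite (HM t o); [reflexivity|lia|intros; apply Ho; lia].
  - intros (u & Hu & Hy).
    destruct (IHd _ _ Hu) as [N HN], (IHc _ _ Hy) as [M HM]; exists (N + M); intros t o Ht Ho.
    rewrite (HN t o); [|lia|intros; apply Ho; lia].
    apply HM; [lia|intros; apply Ho; lia].
  - destruct (pr_surj x) as (a & n & ->); rewrite pi1_pr, pi2_pr.
    revert y; induction n as [|n IHn]; intro y; cbn [nat_rect].
    + rewrite eval_prec_0; auto.
    + rewrite eval_prec_S; intros (v & Hv & Hy).
      destruct (IHn _ Hv) as [N HN], (IHd _ _ Hy) as [M HM]; exists (N + M); intros t o Ht Ho.
      rewrite (HN t o); [|lia|intros; apply Ho; lia].
      apply HM; [lia|intros; apply Ho; lia].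
  - intros [Hy Hlt]; destruct (IHc (pr x y) _ Hy) as [M HM].
    destruct (uniform_bound (fun i N => forall t o, N <= t ->
      (forall n, n < N -> o n = S (r n)) -> 1 < run c o t (pr x i)) y) as [N HN].
    { intros i N N' H HNN t o Ht Ho; apply H; [lia|intros; apply Ho; lia]. }
    { intros i Hi; destruct (Hlt i Hi) as [v Hv]; destruct (IHc (pr x i) _ Hv) as [N HN].
      exists N; intros t o Ht Ho; rewrite (HN t o); auto; lia. }
    (* The search bound must exceed [y], so that the search can reach the true zero. *)
    exists (S (N + M + y)); intros t o Ht Ho.
    assert (E : run c o t (pr x y) = 1) by (apply HM; [lia|intros; apply Ho; lia]).
    destruct (least_spec t (fun i => run c o t (pr x i) <=? 1)) as (Hle & Hmin & Hf).
    set (m := least _ _) in *.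
    assert (m = y) as ->; [|rewrite E; reflexivity].
    destruct (lt_eq_lt_dec m y) as [[H|H]|H]; [|exact H|].
    + assert (Hm : 1 < run c o t (pr x m))
        by (apply HN; [exact H|lia|intros; apply Ho; lia]).
      specialize (Hf ltac:(lia)); apply Nat.leb_le in Hf; lia.
    + specialize (Hmin y H); cbn beta in Hmin; rewrite E in Hmin; discriminate.
Qed.

(** * Choosing colours in the limit *)

Definition eventually (P : nat -> Prop) : Prop := exists N, forall s, N <= s -> P s.

Lemma eventually_and P Q :
  eventually P -> eventually Q -> eventually (fun s => P s /\ Q s).
Proof.
  intros [N HN] [M HM]; exists (N + M); intros s Hs; split; [apply HN|apply HM]; lia.
Qed.

Lemma eventually_impl (P Q : nat -> Prop) :
  (forall s, P s -> Q s) -> eventually P -> eventually Q.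
Proof. intros H [N HN]; exists N; auto. Qed.

(** The threshold may depend on the truth of [P], which is decided classically. *)
Lemma eventually_const (P : Prop) (Q : nat -> Prop) :
  (P -> eventually Q) -> eventually (fun s => P -> Q s).
Proof.
  intro H; destruct (classic P) as [HP|HP].
  - apply eventually_impl with (2 := H HP); auto.
  - exists 0; intros; contradiction.
Qed.

Lemma eventually_list T (l : list T) (P : T -> nat -> Prop) :
  (forall x, In x l -> eventually (P x)) -> eventually (fun s => forall x, In x l -> P x s).
Proof.
  induction l as [|a l IH]; intro H; [exists 0; intros s _ x []|].
  apply eventually_impl with (2 := eventually_and _ _ (H a (or_introl eq_refl))
    (IH (fun x Hx => H x (or_intror Hx)))).
  intros s [Ha Hl] x [<-|Hx]; auto.
Qed.

(** [v x] for an [x] in [l] of maximal weight [w x], or [V] if all weights are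
    below [W]. *)
Fixpoint best (w v : nat -> nat) (l : list nat) (W V : nat) : nat :=
  match l with
  | nil => V
  | x :: l' => if W <=? w x then best w v l' (w x) (v x) else best w v l' W V
  end.

Lemma best_spec w v l W V :
  (best w v l W V = V /\ forall y, In y l -> w y <= W) \/
  (exists x, In x l /\ best w v l W V = v x /\ W <= w x /\ forall y, In y l -> w y <= w x).
Proof.
  revert W V; induction l as [|a l IH]; intros W V; cbn [best].
  - left; split; [reflexivity|intros y []].
  - destruct (Nat.leb_spec W (w a)) as [H|H].
    + right; destruct (IH (w a) (v a)) as [[-> Hy]|(x & Hx & -> & Hw & Hy)].
      * exists a; repeat split; auto using in_eq.
        intros y [<-|Hin]; auto.
      * exists x; repeat split; auto using in_cons; [lia|].
        intros y [<-|Hin]; auto.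
    + destruct (IH W V) as [[-> Hy]|(x & Hx & -> & Hw & Hy)].
      * left; split; [reflexivity|]; intros y [<-|Hin]; auto with arith.
      * right; exists x; repeat split; auto using in_cons.
        intros y [<-|Hin]; auto; lia.
Qed.

(** With initial weight 0 the head of the list is always accepted, so the default [V] never
    survives. *)
Lemma best_spec0 w v l V : l <> nil ->
  exists x, In x l /\ best w v l 0 V = v x /\ forall y, In y l -> w y <= w x.
Proof.
  destruct l as [|a l]; [congruence|intros _; cbn [best Nat.leb]].
  destruct (best_spec w v l (w a) (v a)) as [[-> Hy]|(x & Hx & -> & Hw & Hy)].
  - exists a; repeat split; auto using in_eq; intros y [<-|Hin]; auto.
  - exists x; repeat split; auto using in_cons; intros y [<-|Hin]; auto.
Qed.

Lemma computable_best (w v : nat -> baire -> nat -> nat) l W V :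
  (forall x, computable (w x)) -> (forall x, computable (v x)) ->
  computable W -> computable V ->
  computable (fun p s => best (fun x => w x p s) (fun x => v x p s) l (W p s) (V p s)).
Proof.
  intros Hw Hv; revert W V; induction l as [|x l IH]; intros W V HW HV; cbn [best].
  - exact HV.
  - apply computable_if; [apply computable_leb; auto|apply IH; auto|apply IH; auto].
Qed.

Lemma computable_existsb_list (b : nat -> baire -> nat -> bool) l :
  (forall j, computable (fun p x => Nat.b2n (b j p x))) ->
  computable (fun p x => Nat.b2n (existsb (fun j => b j p x) l)).
Proof.
  intro Hb; induction l as [|j l IH]; cbn [existsb]; [computable|].
  apply computable_orb; auto.
Qed.

(** * Approximating minimal unavoidable sets *)

(** A decidable approximation, using only the candidates below [s], to the claim that [x] witnesses
    the avoidability of [l]. A refutation is never withdrawn. *)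
Definition unrefuted (col : nat -> nat) (le : nat -> nat -> bool) (l : list nat) (s x : nat) : bool :=
  negb (col x =? 0) &&
  forallb (fun y => negb (existsb (fun j => col y =? S j) l && le x y)) (seq 0 s).

(** The least candidate with none of the colours in [l] seen above it by stage
    [s], or [s] if there is none below [s]. *)
Definition stage col le l s : nat := least s (fun x => unrefuted col le l s x).

(** A greedy descent: the element deleted is one whose removal leaves a set of largest [stage],
    hence the one that looks most unavoidable. The result is the last element deleted, passed along
    as the default [d]. *)
Fixpoint pick col le (f d : nat) (l : list nat) (s : nat) : nat :=
  match f with
  | 0 => d
  | S f' =>
      best (fun x => stage col le (remove Nat.eq_dec x l) s)
        (fun x => pick col le f' x (remove Nat.eq_dec x l) s) l 0 d
  end.

(** [f] and [l] are fixed outside the program, so the recursion unfolds into finitely many nested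
    programs and no list has to be coded. *)
Lemma computable_pick (col : baire -> nat -> nat) (le : baire -> nat -> nat -> bool) f d l :
  computable col -> computable (fun p z => Nat.b2n (le p (pi1 z) (pi2 z))) ->
  computable (fun p s => pick (col p) (le p) f d l s).
Proof.
  intros Hcol Hle.
  assert (Hc : forall F, computable F -> computable (fun p x => col p (F p x)))
    by (intro; apply computable_comp, Hcol).
  assert (Hl : forall F G, computable F -> computable G ->
    computable (fun p x => Nat.b2n (le p (F p x) (G p x)))).
  { intros F G; apply computable_comp2 with (H := fun p x y => Nat.b2n (le p x y)), Hle. }
  assert (Hs : forall l, computable (fun p s => stage (col p) (le p) l s)).
  { intro m; unfold stage, unrefuted; computable.
    - apply Hc; computable.
    - apply computable_existsb_list; intro j; computable; apply Hc; computable.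
    - apply Hl; computable. }
  revert d l; induction f as [|f IH]; intros d l; cbn [pick]; [computable|].
  apply computable_best with (w := fun x p s => stage (col p) (le p) (remove Nat.eq_dec x l) s)
    (v := fun x p s => pick (col p) (le p) f x (remove Nat.eq_dec x l) s); auto using computable_const.
Qed.

Lemma pick_in col le f d l s : In (pick col le f d l s) (d :: l).
Proof.
  revert d l; induction f as [|f IH]; intros d l; cbn [pick]; [apply in_eq|].
  destruct l as [|a l]; [apply in_eq|].
  edestruct best_spec0 as (x & Hx & -> & _); [discriminate|].
  specialize (IH x (remove Nat.eq_dec x (a :: l))); cbn beta.
  destruct IH as [<-|IH]; [auto using in_cons|].
  apply in_cons; eapply in_remove, IH.
Qed.

(** [col x] is [0] if [x] is no candidate, and [S j] if [x] witnesses the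
    colour [j]. *)
Record good_candidates (k : nat) (V : nat -> Prop) (A : nat -> Prop)
    (col : nat -> nat) (le : nat -> nat -> bool) : Prop := {
  gc_trans : forall x y z, le x y = true -> le y z = true -> le x z = true;
  gc_refl : forall x, col x <> 0 -> le x x = true;
  gc_inhabited : exists x, col x <> 0;
  gc_dense : forall x, col x <> 0 -> exists y, A y /\ le x y = true;
  gc_upwards : forall x y, A x -> le x y = true -> col y <> 0 -> A y;
  gc_valid : forall x, A x -> exists j, col x = S j /\ j < k /\ V j
}.

Section Pick.

Variables (k : nat) (V A : nat -> Prop) (col : nat -> nat) (le : nat -> nat -> bool).
Hypothesis H : good_candidates k V A col le.

Definition avoidable (l : list nat) : Prop :=
  exists x, col x <> 0 /\ forall y j, In j l -> col y = S j -> le x y = false.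

Lemma avoidable_nil : avoidable nil.
Proof. destruct (gc_inhabited _ _ _ _ _ H) as [x Hx]; exists x; split; [exact Hx|intros y j []]. Qed.

Lemma avoidable_incl l m : incl l m -> avoidable m -> avoidable l.
Proof. intros Hlm (x & Hx & Hy); exists x; split; [exact Hx|eauto]. Qed.

(** Move from the witness [x] to some [y] in [A] above it. Every candidate above [y] is again in [A]
    and so has a valid colour other than [j]; the colours in [l] stay excluded by transitivity. *)
Lemma avoidable_cons j l : ~ V j -> avoidable l -> avoidable (j :: l).
Proof.
  intros Hj (x & Hx & Hl).
  destruct (gc_dense _ _ _ _ _ H x Hx) as (y & Ay & Hxy); exists y; split.
  - destruct (gc_valid _ _ _ _ _ H y Ay) as (i & -> & _); discriminate.
  - intros z i Hi Hz; apply not_true_is_false; intro Hyz.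
    assert (Az : A z) by (apply (gc_upwards _ _ _ _ _ H y); congruence).
    destruct (gc_valid _ _ _ _ _ H z Az) as (i' & Hi' & _ & Vi').
    destruct Hi as [->|Hi]; [congruence|].
    assert (Hxz := gc_trans _ _ _ _ _ H _ _ _ Hxy Hyz).
    rewrite (Hl z i Hi Hz) in Hxz; discriminate.
Qed.

(** Density puts a member of [A], whose colour is below [k], above any candidate. *)
Lemma not_avoidable_all : ~ avoidable (seq 0 k).
Proof.
  intros (x & Hx & Hl).
  destruct (gc_dense _ _ _ _ _ H x Hx) as (y & Ay & Hxy).
  destruct (gc_valid _ _ _ _ _ H y Ay) as (j & Hj & Hjk & _).
  rewrite (Hl y j) in Hxy; [discriminate|apply in_seq; lia|exact Hj].
Qed.

(** A true witness is never refuted, so the least unrefuted candidate cannot pass it. *)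
Lemma stage_bounded l : avoidable l -> exists b, forall s, stage col le l s <= b.
Proof.
  intros (x & Hx & Hl); exists x; intro s; unfold stage.
  destruct (least_spec s (fun x => unrefuted col le l s x)) as (Hle & Hlt & _).
  apply Nat.le_ngt; intro Hs; specialize (Hlt x Hs); cbn beta in Hlt.
  apply not_true_iff_false in Hlt; apply Hlt; unfold unrefuted.
  apply andb_true_intro; split; [apply negb_true_iff, Nat.eqb_neq, Hx|].
  apply forallb_forall; intros y _; apply negb_true_iff, andb_false_iff.
  destruct existsb eqn:E; [right|left; reflexivity].
  apply existsb_exists in E; destruct E as (j & Hj & Ej); apply Nat.eqb_eq in Ej; eauto.
Qed.

(** Each [x <= b] is eventually refuted for good, and finitely many thresholds have a common
    bound. *)
Lemma stage_unbounded l b : ~ avoidable l -> eventually (fun s => b < stage col le l s).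
Proof.
  intro Hl.
  destruct (uniform_bound (fun x N => forall s, N <= s -> unrefuted col le l s x = false) (S b))
    as [N HN].
  - intros x N M HN HNM s Hs; apply HN; lia.
  - intros x _; destruct (Nat.eq_dec (col x) 0) as [E|E].
    + exists 0; intros s _; unfold unrefuted; rewrite E; reflexivity.
    + destruct (classic (exists y j, In j l /\ col y = S j /\ le x y = true))
        as [(y & j & Hj & Hy & Hxy)|Hn].
      (* The refuting [y] is inspected from stage [S y] on. *)
      * exists (S y); intros s Hs; apply not_true_is_false; unfold unrefuted; intro Ht.
        apply andb_true_iff in Ht; destruct Ht as [_ Ht]; rewrite forallb_forall in Ht.
        specialize (Ht y ltac:(apply in_seq; lia)); apply negb_true_iff in Ht.
        rewrite Hxy, andb_true_r in Ht; apply not_true_iff_false in Ht; apply Ht.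
        apply existsb_exists; exists j; split; [exact Hj|apply Nat.eqb_eq, Hy].
      * exfalso; apply Hl; exists x; split; [exact E|].
        intros y j Hj Hy; apply not_true_is_false; intro Hxy; apply Hn; eauto.
  - exists (N + S b); intros s Hs; unfold stage.
    destruct (least_spec s (fun x => unrefuted col le l s x)) as (_ & _ & Hf).
    apply Nat.lt_nge; intro Hb; rewrite HN in Hf by lia.
    specialize (Hf ltac:(lia)); discriminate.
Qed.

Lemma stage_separates l m :
  avoidable l -> ~ avoidable m -> eventually (fun s => stage col le l s < stage col le m s).
Proof.
  intros Hl Hm; destruct (stage_bounded l Hl) as [b Hb].
  apply eventually_impl with (2 := stage_unbounded m b Hm); intros s Hs.
  specialize (Hb s); lia.
Qed.

(** Eventually unavoidable sets outweigh avoidable ones, so that [pick] descends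
    to a minimal unavoidable set; by [avoidable_cons] all its elements are in [V]. *)
Lemma pick_valid f d l :
  length l <= f -> ~ avoidable l -> eventually (fun s => V (pick col le f d l s)).
Proof.
  revert d l; induction f as [|f IH]; intros d l Hf Hl.
  { destruct l; [contradiction (Hl avoidable_nil)|cbn in Hf; lia]. }
  assert (Hnil : l <> nil) by (intros ->; apply Hl, avoidable_nil).
  set (rem x := remove Nat.eq_dec x l).
  destruct (classic (exists x, In x l /\ ~ avoidable (rem x))) as [(x & Hx & Ux)|Hmin].
  - assert (E1 : eventually (fun s => forall y, In y l ->
      ~ avoidable (rem y) -> V (pick col le f y (rem y) s))).
    { apply eventually_list; intros y Hy; apply eventually_const; intro Uy.
      apply IH; [|exact Uy].
      assert (Hlt := remove_length_lt Nat.eq_dec l y Hy); fold (rem y) in Hlt; lia. }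
    assert (E2 : eventually (fun s => forall y, In y l ->
      avoidable (rem y) -> stage col le (rem y) s < stage col le (rem x) s)).
    { apply eventually_list; intros y Hy; apply eventually_const; intro Uy.
      apply stage_separates; assumption. }
    apply eventually_impl with (2 := eventually_and _ _ E1 E2); intros s [F1 F2].
    cbn [pick]; edestruct best_spec0 as (y & Hy & -> & Hmax); [exact Hnil|].
    apply F1; [exact Hy|]; intro Uy.
    specialize (F2 y Hy Uy); specialize (Hmax x Hx); cbn beta in Hmax.
    fold (rem x) (rem y) in Hmax; lia.
  (* Here [l] is minimal unavoidable. All its elements are valid, and every later deletion is made
     inside it. *)
  - assert (HV : forall x, In x l -> V x).
    { intros x Hx; apply NNPP; intro Vx; apply Hl.
      apply avoidable_incl with (x :: rem x).
      - intros y Hy; destruct (Nat.eq_dec x y) as [->|N]; [apply in_eq|].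
        apply in_cons, in_in_remove; congruence.
      - apply avoidable_cons; [exact Vx|].
        apply NNPP; intro Ux; apply Hmin; eauto. }
    exists 0; intros s _; apply HV.
    cbn [pick]; edestruct best_spec0 as (y & Hy & -> & _); [exact Hnil|].
    destruct (pick_in col le f y (remove Nat.eq_dec y l) s) as [<-|Hin]; [exact Hy|].
    eapply in_remove, Hin.
Qed.

End Pick.

(** * Infinitely recurring colours as a finite problem *)

Definition crt (k : nat) : fin_problem k :=
  FinProblem (fun (c : colouring_space k) (i : fin_space k) =>
    forall m, exists n, m <= n /\ c n = i).

(** Pigeonhole: otherwise every colour dies out, and past a common bound no colour is left. *)
Lemma crt_total k (c : nat -> colour k) : dom (crt k) c.
Proof.
  apply NNPP; intro Hn.
  assert (Hi : forall i : colour k, eventually (fun n => c n <> i)).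
  { intro i; apply NNPP; intro Hi; apply Hn; exists i; intro m.
    apply NNPP; intro Hm; apply Hi; exists m; intros n Hmn E; apply Hm; eauto. }
  destruct (uniform_bound (fun i N => forall n, N <= n -> proj1_sig (c n) <> i) k)
    as [N HN].
  - intros i N M HN HNM n Hn'; apply HN; lia.
  - intros i Hik; destruct (Hi (exist _ i Hik)) as [N HN].
    exists N; intros n Hn' E; apply (HN n Hn'), colour_eq, E.
  - exact (HN _ (proj2_sig (c N)) N (le_n N) eq_refl).
Qed.

(** The colouring sent to [crt] is the sequence of values of [pick]. From some stage on these are
    solutions, so any recurring colour is one and can be returned unchanged. *)
Lemma fin_le_crt k (G : fin_problem k) Phi
    (col : baire -> nat -> nat) (le : baire -> nat -> nat -> bool) :
  0 < k -> computable col -> computable (fun o z => Nat.b2n (le o (pi1 z) (pi2 z))) ->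
  (forall p x, names p x -> dom G x -> exists q A, computes Phi p q /\
     good_candidates k (fun j => exists y, proj1_sig y = j /\ solution G x y) A
       (col (join p q)) (le (join p q))) ->
  G <=W crt k.
Proof.
  intros hk Hcol Hle HG.
  destruct (computable_pick col le k 0 (seq 0 k) Hcol Hle) as [cp Hcp].
  assert (HO : computable (fun o n => odds o n)) by computable; destruct HO as [co Hco].
  destruct (computes_join Oracle Phi) as [cj Hcj].
  exists (subst cj cp), co; intros p x Hp Hx.
  destruct (HG p x Hp Hx) as (q & A & Hq & Hgood).
  assert (Hlt : forall s, pick (col (join p q)) (le (join p q)) k 0 (seq 0 k) s < k).
  { intro s; destruct (pick_in (col (join p q)) (le (join p q)) k 0 (seq 0 k) s) as [<-|Hin];
      [exact hk|apply in_seq in Hin; lia]. }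
  set (c := (fun s => exist (fun i => i < k) _ (Hlt s)) : nat -> colour k).
  exists (fun s => proj1_sig (c s)), c; repeat split.
  - apply computes_subst with (join p q); [apply Hcj; [intro; reflexivity|exact Hq]|apply Hcp].
  - apply crt_total.
  - intros r i Hr Hi.
    destruct (pick_valid _ _ _ _ _ Hgood k 0 (seq 0 k)) as [N HN];
      [rewrite length_seq; lia|eapply not_avoidable_all, Hgood|].
    destruct (Hi N) as (n & Hn & Ei); destruct (HN n Hn) as (y & Ey & Sy).
    assert (y = i) as -> by (apply colour_eq; rewrite Ey, <- Ei; reflexivity).
    exists r, i; repeat split; auto.
    intro m; specialize (Hco (join p r) m); cbn beta in Hco; rewrite odds_join in Hco; exact Hco.
Qed.

(** * Finite problems below [BS] and [SDDCC] *)

(** The oracle format of [run]: [p] is total and gets a successor, while [f] already uses 0 for a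
    missing answer. *)
Definition partial_join (p f : baire) : baire :=
  fun m => if Nat.even m then S (p (Nat.div2 m)) else f (Nat.div2 m).

Lemma partial_join_sound p f r :
  (forall n v, f n = S v -> r n = v) ->
  forall n v, partial_join p f n = S v -> join p r n = v.
Proof. intros Hf n v; unfold partial_join, join; destruct Nat.even; auto. Qed.

Lemma partial_join_complete p f r N :
  (forall n, n < N -> f n = S (r n)) ->
  forall n, n < N -> partial_join p f n = S (join p r n).
Proof.
  intros Hf n Hn; unfold partial_join, join; destruct Nat.even; auto.
  apply Hf; pose proof (Nat.le_div2_diag_l n); lia.
Qed.

(** Arithmetic on codes of [enc_list]: removing the successor and projecting gives the tail. The
    code 0 of the empty list is a fixed point, so reading past the end is safe. *)
Definition drop_code (z i : nat) : nat :=
  nat_rect (fun _ => nat) z (fun _ v => pi2 (Nat.pred v)) i.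

Definition item (z i : nat) : nat := pi1 (Nat.pred (drop_code z i)).

Lemma drop_code_enc_list l i : drop_code (enc_list l) i = enc_list (skipn i l).
Proof.
  unfold drop_code; induction i as [|i IH]; [reflexivity|]; cbn [nat_rect]; rewrite IH.
  rewrite <- Nat.add_1_l, <- skipn_skipn.
  destruct (skipn i l) as [|x m]; [reflexivity|apply pi2_pr].
Qed.

Lemma item_enc_list l i : item (enc_list l) i = nth i l 0.
Proof.
  unfold item; rewrite drop_code_enc_list, <- (Nat.add_0_r i) at 1.
  rewrite <- (Nat.add_0_r i) at 2; rewrite <- nth_skipn, Nat.add_0_r.
  destruct (skipn i l) as [|x m]; [reflexivity|apply pi1_pr].
Qed.

Lemma nth_map_seq (f : nat -> nat) n i : i < n -> nth i (map f (seq 0 n)) 0 = f i.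
Proof.
  intro Hi; rewrite nth_indep with (d' := f 0) by (rewrite length_map, length_seq; exact Hi).
  rewrite map_nth, seq_nth; auto.
Qed.

Lemma item_prefix (f : nat -> nat) n : exists z, forall i, i < n -> item z i = f i.
Proof.
  exists (enc_list (map f (seq 0 n))); intros i Hi.
  rewrite item_enc_list; apply nth_map_seq, Hi.
Qed.

Lemma computable_drop_code F G :
  computable F -> computable G -> computable (fun p x => drop_code (F p x) (G p x)).
Proof. intros; unfold drop_code; computable. Qed.

Lemma computable_item F G :
  computable F -> computable G -> computable (fun p x => item (F p x) (G p x)).
Proof. intros; unfold item; computable; apply computable_drop_code; assumption. Qed.

Lemma infinite_enum (H : nat -> bool) : infinite H ->
  exists h, (forall i, H (h i) = true) /\ forall i j, i < j -> h i < h j.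
Proof.
  intro Hinf.
  (* Membership is boolean, so the next element is found by unbounded search, without a choice
     axiom. *)
  assert (next : forall m, { n | m <= n /\ H n = true }).
  { intro m; apply constructive_indefinite_ground_description_nat; [|apply Hinf].
    intro n; destruct (le_dec m n); [|right; tauto].
    destruct (H n); [left; auto|right; intros [_ [=]]]. }
  set (h := nat_rect (fun _ => nat) (proj1_sig (next 0)) (fun _ v => proj1_sig (next (S v)))).
  assert (HS : forall i, h i < h (S i)) by (intro i; exact (proj1 (proj2_sig (next (S (h i)))))).
  exists h; split.
  - intros [|i]; apply (proj2_sig (next _)).
  - intros i j Hij; induction Hij as [|j Hij IH]; [apply HS|].
    specialize (HS j); lia.
Qed.

(** * Surgery on bad sequences *)

Definition bad_prefix (R : nat * nat -> bool) (n : nat) (f : nat -> nat) : Prop :=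
  (forall j, j < n -> R (f j, f j) = true) /\
  (forall i j, i < j < n -> R (f i, f j) = false).

Section QuasiOrder.

Variable R : nat * nat -> bool.
Hypothesis HR : quasi_order R.

(** The new sequence is [g] followed by the tail of [rho] after [f]. A relation from a term of [g]
    to that tail would, by transitivity, relate a term of [f] to it, contradicting badness of [rho].
    This yields upward closure of the extendible candidates. *)
Lemma bad_splice rho n f m g :
  bad R rho -> (forall i, i < n -> rho i = f i) -> bad_prefix R m g ->
  (forall j, j < m -> exists i, i < n /\ R (f i, g j) = true) ->
  exists rho', bad R rho' /\ forall j, j < m -> rho' j = g j.
Proof.
  intros [Hu Hb] Hf [Gu Gb] Hfg.
  exists (fun i => if i <? m then g i else rho (n + (i - m))); split; [split|].
  - intro i; destruct (Nat.ltb_spec i m); [apply Gu; assumption|apply Hu].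
  - intros i j Hij; destruct (Nat.ltb_spec i m), (Nat.ltb_spec j m).
    + apply Gb; lia.
    + apply not_true_is_false; intro E.
      destruct (Hfg i) as (h & Hh & Eh); [assumption|].
      assert (E' := proj2 HR _ _ _ Eh E).
      rewrite <- (Hf h Hh), Hb in E'; [discriminate|lia].
    + lia.
    + apply Hb; lia.
  - intros j Hj; destruct (Nat.ltb_spec j m); [reflexivity|lia].
Qed.

(** If no tail of [rho] can be appended to [f], then [rho] meets the upward
    closure of [f] infinitely often. *)
Lemma bad_extends_or_refines rho n f :
  bad R rho -> bad_prefix R n f ->
  (exists rho', bad R rho' /\ forall i, i < n -> rho' i = f i) \/
  (exists rho', bad R rho' /\ forall j, exists i, i < n /\ R (f i, rho' j) = true).
Proof.
  intros [Hu Hb] [Fu Fb].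
  set (met j := existsb (fun i => R (f i, rho j)) (seq 0 n)).
  destruct (classic (infinite met)) as [Hinf|Hfin].
  - right; destruct (infinite_enum _ Hinf) as (h & Hmet & Hh).
    (* A subsequence of a bad sequence is bad. *)
    exists (fun i => rho (h i)); split; [split; auto|].
    intro j; specialize (Hmet j).
    apply existsb_exists in Hmet; destruct Hmet as (i & Hi & E); apply in_seq in Hi.
    exists i; split; [lia|exact E].
  - left; apply not_all_ex_not in Hfin; destruct Hfin as [m Hm].
    assert (Hup : forall i j, i < n -> m <= j -> R (f i, rho j) = false).
    { intros i j Hi Hj; apply not_true_is_false; intro E; apply Hm; exists j.
      split; [exact Hj|]; apply existsb_exists; exists i; split; [apply in_seq; lia|exact E]. }
    exists (fun i => if i <? n then f i else rho (m + (i - n))); split; [split|].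
    + intro i; destruct (Nat.ltb_spec i n); [apply Fu; assumption|apply Hu].
    + intros i j Hij; destruct (Nat.ltb_spec i n), (Nat.ltb_spec j n);
        [apply Fb; lia|apply Hup; lia|lia|apply Hb; lia].
    + intros i Hi; destruct (Nat.ltb_spec i n); [reflexivity|lia].
Qed.

End QuasiOrder.

(** Candidates for [BS] are triples (length, list code, fuel), compared by
    inclusion of the upward closures of the lists. *)
Definition bs_check (q : baire) (n z : nat) : bool :=
  forallb (fun j => (q (pr (item z j) (item z j)) =? 1) &&
    forallb (fun i => q (pr (item z i) (item z j)) =? 0) (seq 0 j)) (seq 0 n).

(** Only output position 0 is computed, since it alone determines a name in [fin_space]. The answer
    convention of [run] is exactly the one for candidate colours. *)
Definition bs_col (Psi : code) (o : baire) (x : nat) : nat :=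
  if bs_check (odds o) (pi1 x) (pi1 (pi2 x)) then
    run Psi (fun m => partial_join (evens o)
      (fun i => if i <? pi1 x then S (item (pi1 (pi2 x)) i) else 0) m) (pi2 (pi2 x)) 0
  else 0.

Definition bs_le (o : baire) (x y : nat) : bool :=
  forallb (fun j => existsb (fun i =>
    odds o (pr (item (pi1 (pi2 x)) i) (item (pi1 (pi2 y)) j)) =? 1) (seq 0 (pi1 x)))
    (seq 0 (pi1 y)).

Lemma computable_bs_col Psi : computable (bs_col Psi).
Proof.
  unfold bs_col, bs_check; apply computable_if; [| |computable].
  - repeat (computable; try apply computable_item).
  - apply computable_run; [|computable|computable].
    unfold partial_join; repeat (computable; try apply computable_item).
Qed.

Lemma computable_bs_le : computable (fun o z => Nat.b2n (bs_le o (pi1 z) (pi2 z))).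
Proof. unfold bs_le; repeat (computable; try apply computable_item). Qed.

Lemma b2n_eq1 b : (Nat.b2n b =? 1) = b.
Proof. destruct b; reflexivity. Qed.

Lemma b2n_eq0 b : (Nat.b2n b =? 0) = negb b.
Proof. destruct b; reflexivity. Qed.

Lemma bs_check_iff (R : nat * nat -> bool) q n z :
  (forall x y, q (pr x y) = Nat.b2n (R (x, y))) ->
  bs_check q n z = true <-> bad_prefix R n (item z).
Proof.
  intro Hq; unfold bs_check; rewrite forallb_forall; split.
  - intro H; split.
    + intros j Hj; specialize (H j ltac:(apply in_seq; lia)).
      apply andb_true_iff in H; destruct H as [H _]; rewrite Hq, b2n_eq1 in H; exact H.
    + intros i j Hij; specialize (H j ltac:(apply in_seq; lia)).
      apply andb_true_iff in H; destruct H as [_ H]; rewrite forallb_forall in H.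
      specialize (H i ltac:(apply in_seq; lia)); rewrite Hq, b2n_eq0 in H.
      apply negb_true_iff, H.
  - intros [Hu Hb] j Hj; apply in_seq in Hj; apply andb_true_iff; split.
    + rewrite Hq, b2n_eq1; apply Hu; lia.
    + apply forallb_forall; intros i Hi; apply in_seq in Hi.
      rewrite Hq, b2n_eq0; apply negb_true_iff, Hb; lia.
Qed.

Lemma bs_le_iff (R : nat * nat -> bool) p q x y :
  (forall x y, q (pr x y) = Nat.b2n (R (x, y))) ->
  bs_le (join p q) x y = true <->
  forall j, j < pi1 y -> exists i, i < pi1 x /\
    R (item (pi1 (pi2 x)) i, item (pi1 (pi2 y)) j) = true.
Proof.
  intro Hq; unfold bs_le; rewrite odds_join, forallb_forall; split; intros H j Hj.
  - specialize (H j ltac:(apply in_seq; lia)); apply existsb_exists in H.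
    destruct H as (i & Hi & E); apply in_seq in Hi; rewrite Hq, b2n_eq1 in E.
    exists i; split; [lia|exact E].
  - apply in_seq in Hj; destruct (H j) as (i & Hi & E); [lia|].
    apply existsb_exists; exists i; split; [apply in_seq; lia|].
    rewrite Hq, b2n_eq1; exact E.
Qed.

Lemma fin_le_BS k (G : fin_problem k) : 0 < k -> G <=W BS -> G <=W crt k.
Proof.
  intros hk (Phi & Psi & HG).
  apply fin_le_crt with (Phi := Phi) (col := bs_col Psi) (le := bs_le);
    auto using computable_bs_col, computable_bs_le.
  intros p x Hp Hx; destruct (HG p x Hp Hx) as (q & R & Hq & HqR & (rho0 & HR & Hnw & Hrho0) & K).
  assert (HqR' : forall a b, q (pr a b) = Nat.b2n (R (a, b))) by (intros; apply HqR).
  assert (K' : forall rho, bad R rho -> exists s y,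
    computes Psi (join p rho) s /\ s 0 = proj1_sig y /\ solution G x y).
  { intros rho Hrho; apply (K rho rho); [intro; reflexivity|exact (conj HR (conj Hnw Hrho))]. }
  clear K.
  assert (Hcol : forall x, bs_col Psi (join p q) x <> 0 ->
    bad_prefix R (pi1 x) (item (pi1 (pi2 x)))).
  { intro c; unfold bs_col; rewrite odds_join.
    destruct bs_check eqn:E; [intros _|congruence].
    revert E; apply bs_check_iff, HqR'. }
  assert (Hle := fun x y => bs_le_iff R p q x y HqR').
  (* The candidates that extend to an infinite bad sequence. *)
  set (A c := bs_col Psi (join p q) c <> 0 /\
    exists rho, bad R rho /\ forall i, i < pi1 c -> rho i = item (pi1 (pi2 c)) i).
  assert (HA : forall rho, bad R rho -> exists c, A c /\
    forall i, i < pi1 c -> item (pi1 (pi2 c)) i = rho i).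
  { intros rho Hrho; destruct (K' rho Hrho) as (s & y & Hs & _ & _).
    destruct (run_complete _ _ _ _ (Hs 0)) as [N HN].
    destruct (item_prefix rho N) as [z Hz].
    assert (Hz' : forall i, i < pi1 (pr N (pr z N)) ->
      item (pi1 (pi2 (pr N (pr z N)))) i = rho i) by (rewrite pi1_pr, pi2_pr, pi1_pr; exact Hz).
    (* The bound [N] from [run_complete] serves both as the length of the prefix and as the fuel. *)
    exists (pr N (pr z N)); split; [split|exact Hz'].
    - unfold bs_col; rewrite odds_join, evens_join.
      assert (bs_check q (pi1 (pr N (pr z N))) (pi1 (pi2 (pr N (pr z N)))) = true) as ->.
      { apply (bs_check_iff R q _ _ HqR'); destruct Hrho as [Hu Hb]; split.
        - intros j Hj; rewrite Hz' by exact Hj; apply Hu.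
        - intros i j Hij; rewrite !Hz' by lia; apply Hb; lia. }
      rewrite !pi2_pr, !pi1_pr, HN; [discriminate|apply le_n|].
      apply partial_join_complete; intros n Hn.
      destruct (Nat.ltb_spec n N); [rewrite Hz; auto|lia].
    - exists rho; split; [exact Hrho|]; intros i Hi; symmetry; apply Hz', Hi. }
  exists q, A; split; [exact Hq|split].
  - intros a b c; rewrite !Hle; intros Hab Hbc j Hj.
    destruct (Hbc j Hj) as (i & Hi & E), (Hab i Hi) as (h & Hh & E').
    exists h; split; [exact Hh|exact (proj2 HR _ _ _ E' E)].
  - intros c Hc; apply Hle; intros j Hj; exists j; split; [exact Hj|].
    apply (proj1 (Hcol c Hc)), Hj.
  - destruct (HA rho0 Hrho0) as (c & [Hc _] & _); eauto.
  - intros c Hc.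
    (* Density: either [c] itself is extendible, or a long enough prefix of the refined sequence is
       a member of [A] above [c]. *)
    destruct (bad_extends_or_refines R rho0 _ _ Hrho0 (Hcol c Hc))
      as [(rho & Hrho & Hext)|(rho & Hrho & Hup)].
    + exists c; split; [split; eauto|].
      apply Hle; intros j Hj; exists j; split; [exact Hj|apply (proj1 (Hcol c Hc)), Hj].
    + destruct (HA rho Hrho) as (c' & Hc' & Heq); exists c'; split; [exact Hc'|].
      apply Hle; intros j Hj; rewrite Heq by exact Hj; apply Hup.
  - intros a b [_ (rho & Hrho & Hext)] Hab Hb; split; [exact Hb|].
    apply bad_splice with (1 := HR) (2 := Hrho) (3 := Hext); [apply Hcol, Hb|apply Hle, Hab].
  - intros c [Hc (rho & Hrho & Hext)].
    destruct (bs_col Psi (join p q) c) as [|j] eqn:E; [congruence|].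
    destruct (K' rho Hrho) as (s & y & Hs & Hy & Sy).
    assert (Ej : j = proj1_sig y).
    { rewrite <- Hy; apply eval_fun with (2 := Hs 0).
      revert E; unfold bs_col; rewrite evens_join; destruct bs_check; [|discriminate].
      apply run_sound, partial_join_sound; intros n v.
      destruct (Nat.ltb_spec n (pi1 c)) as [Hn|]; [|discriminate].
      intro Ev; rewrite Hext by exact Hn; congruence. }
    exists j; repeat split; [rewrite Ej; apply (proj2_sig y)|eauto].
Qed.

(** Candidates for [SDDCC] are pairs (element, fuel). *)
Definition sddcc_col (Psi : code) (o : baire) (x : nat) : nat :=
  if odds o (2 * pr (pi1 x) (pi1 x)) =? 1 then
    run Psi (fun m => partial_join (evens o)
      (fun i => S (if i =? 0 then pi1 x else 0)) m) (pi2 x) 0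
  else 0.

Definition sddcc_le (o : baire) (x y : nat) : bool :=
  odds o (2 * pr (pi1 x) (pi1 y)) =? 1.

Lemma computable_sddcc_col Psi : computable (sddcc_col Psi).
Proof.
  unfold sddcc_col; apply computable_if; [| |computable].
  - computable; apply computable_double; computable.
  - apply computable_run; [|computable|computable]; unfold partial_join; computable.
Qed.

Lemma computable_sddcc_le : computable (fun o z => Nat.b2n (sddcc_le o (pi1 z) (pi2 z))).
Proof. unfold sddcc_le; computable; apply computable_double; computable. Qed.

Lemma fin_le_SDDCC k (G : fin_problem k) : 0 < k -> G <=W SDDCC -> G <=W crt k.
Proof.
  intros hk (Phi & Psi & HG).
  apply fin_le_crt with (Phi := Phi) (col := sddcc_col Psi) (le := sddcc_le);
    auto using computable_sddcc_col, computable_sddcc_le.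
  intros p x Hp Hx; destruct (HG p x Hp Hx) as
    (q & [R T] & Hq & [HqR _] & (a0 & HR & HT & HTR & Hdense & Hup & Ha0) & K).
  cbn [fst snd] in *.
  (* The order occupies the even half of the instance, whence the factor 2. *)
  assert (HqR' : forall a b, (q (2 * pr a b) =? 1) = R (a, b)).
  { intros a b; rewrite <- (b2n_eq1 (R (a, b))); f_equal; apply (HqR (a, b)). }
  (* A full name of [a]. The candidate oracle is thus total, and the fuel only bounds searches. *)
  set (name a := fun i => if i =? 0 then a else 0).
  assert (K' : forall a, coded T a -> exists s y,
    computes Psi (join p (name a)) s /\ s 0 = proj1_sig y /\ solution G x y).
  { intros a Ha; apply (K (name a) a); [reflexivity|].
    exact (conj HR (conj HT (conj HTR (conj Hdense (conj Hup Ha))))). }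
  clear K.
  assert (Hle : forall a b, sddcc_le (join p q) a b = R (pi1 a, pi1 b)).
  { intros a b; unfold sddcc_le; rewrite odds_join; apply HqR'. }
  assert (Hcol : forall c, sddcc_col Psi (join p q) c =
    if R (pi1 c, pi1 c) then run Psi (partial_join p (fun i => S (name (pi1 c) i))) (pi2 c) 0
    else 0).
  { intro c; unfold sddcc_col; rewrite odds_join, evens_join, HqR'; reflexivity. }
  set (A c := sddcc_col Psi (join p q) c <> 0 /\ coded T (pi1 c)).
  assert (HA : forall a, coded T a -> exists c, A c /\ pi1 c = a).
  { intros a Ha; destruct (K' a Ha) as (s & y & Hs & _ & _).
    destruct (run_complete _ _ _ _ (Hs 0)) as [N HN].
    exists (pr a N); unfold A; rewrite Hcol, pi1_pr, pi2_pr.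
    replace (R (a, a)) with true by (symmetry; apply HTR, Ha).
    rewrite HN; [auto|apply le_n|apply partial_join_complete; reflexivity]. }
  exists q, A; split; [exact Hq|split].
  - intros a b c; rewrite !Hle; apply (proj2 (proj1 HR)).
  - intros c; rewrite Hcol, Hle; destruct R; congruence.
  - destruct (HA a0 Ha0) as (c & [Hc _] & _); eauto.
  - intros c Hc; destruct (Hdense (pi1 c)) as (u & Hcu & Hu).
    { unfold underlying; rewrite Hcol in Hc; destruct R; congruence. }
    destruct (HA u Hu) as (c' & Hc' & <-); exists c'; rewrite Hle; auto.
  - intros a b [_ Ha] Hab Hb; split; [exact Hb|].
    rewrite Hle in Hab; exact (Hup _ _ Ha Hab).
  - intros c [Hc Hcc].
    destruct (sddcc_col Psi (join p q) c) as [|j] eqn:E; [congruence|].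
    destruct (K' _ Hcc) as (s & y & Hs & Hy & Sy).
    assert (Ej : j = proj1_sig y).
    { rewrite <- Hy; apply eval_fun with (2 := Hs 0).
      revert E; rewrite Hcol; destruct R; [|discriminate].
      apply run_sound, partial_join_sound; congruence. }
    exists j; repeat split; [rewrite Ej; apply (proj2_sig y)|eauto].
Qed.

(** * Reductions from infinitely recurring colours *)

Lemma computes_oracle p : computes Oracle p p.
Proof. intro n; reflexivity. Qed.

(** The instance is passed on unchanged; the backward program searches for the first element of the
    homogeneous set and returns its colour. *)
Lemma crt_le_RT1 k : crt k <=W RT1 k.
Proof.
  (* [Mu] looks for zeros, so membership is negated. *)
  assert (HM : computable (fun o z => Nat.b2n (odds o (pi2 z) =? 0))) by computable.
  assert (HE : computable (fun o x => evens o x)) by computable.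
  destruct HM as [cm Hm], HE as [ce He].
  exists Oracle, (Comp ce (Mu cm)); intros p c Hp [i Hi].
  exists p, c; repeat apply conj; [apply computes_oracle|exact Hp| |].
  - exists (fun n => proj1_sig (c n) =? proj1_sig i); split.
    + intro m; destruct (Hi m) as (n & Hn & E); exists n; split; [exact Hn|].
      rewrite E; apply Nat.eqb_refl.
    + exists i; intros n E; apply Nat.eqb_eq in E; apply colour_eq, E.
  - intros r H Hr [Hinf [j Hj]].
    destruct (Hinf 0) as (m & _ & Hm').
    destruct (least_spec (S m) H) as (_ & Hlt & Hf); set (n := least (S m) H) in *.
    assert (Hn : H n = true).
    { apply Hf; apply Nat.nle_gt; intro Hmn; specialize (Hlt m Hmn); congruence. }
    exists (fun _ => p n), (c n); repeat split.
    + intro x; exists n; split.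
      * assert (Hz : forall i, eval (join p r) cm (pr x i) (Nat.b2n (negb (H i)))).
        { intro l; specialize (Hm (join p r) (pr x l)); cbn beta in Hm.
          rewrite odds_join, pi2_pr, (Hr l), b2n_eq0 in Hm; exact Hm. }
        split; [specialize (Hz n); rewrite Hn in Hz; exact Hz|].
        intros l Hl; exists 0; specialize (Hz l); rewrite (Hlt l Hl) in Hz; exact Hz.
      * specialize (He (join p r) n); cbn beta in He; rewrite evens_join in He; exact He.
    + apply Hp.
    + intro l; destruct (Hinf l) as (n' & Hn' & E); exists n'; split; [exact Hn'|].
      rewrite (Hj n' E), (Hj n Hn); reflexivity.
Qed.

Lemma RT1_le_crt k : RT1 k <=W crt k.
Proof.
  assert (HP : computable (fun o n => Nat.b2n (evens o n =? odds o 0))) by computable.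
  destruct HP as [cp Hc].
  exists Oracle, cp; intros p c Hp _.
  exists p, c; repeat apply conj; [apply computes_oracle|exact Hp|apply crt_total|].
  intros r i Hr Hi.
  exists (fun n => Nat.b2n (p n =? r 0)), (fun n => p n =? r 0); repeat split.
  - intro n; specialize (Hc (join p r) n); cbn beta in Hc.
    rewrite evens_join, odds_join in Hc; exact Hc.
  - intro m; destruct (Hi m) as (n & Hn & E); exists n; split; [exact Hn|].
    apply Nat.eqb_eq; rewrite (Hp n), E; symmetry; exact Hr.
  - exists i; intros n E; apply Nat.eqb_eq in E; apply colour_eq.
    rewrite <- (Hp n), E; exact Hr.
Qed.

(** Both functionals are trivial: in a linear order, the failure of [R (s i, s (S i))] means a
    strict descent. *)
Lemma DS_le_BS : DS <=W BS.
Proof.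
  assert (HO : computable (fun o n => odds o n)) by computable; destruct HO as [co Ho].
  exists Oracle, co; intros p R Hp (s0 & HR & Hill & Hs0).
  pose proof HR as [[[Hund Htr] Hanti] Htot].
  assert (Hdec : forall i j, i < j -> R (s0 j, s0 i) = true /\ R (s0 i, s0 j) = false).
  { intros i j Hij.
    assert (E : j = S i \/ S i < j) by lia.
    assert (Hd : forall i, R (s0 (S i), s0 i) = true) by (intro; apply Hs0).
    assert (Hle : forall l, R (s0 (l + S i), s0 (S i)) = true).
    { induction l as [|l IH]; [apply (Hund _ _ (Hd i))|].
      exact (Htr _ _ _ (Hd (l + S i)) IH). }
    specialize (Hle (j - S i)); replace (j - S i + S i) with j in Hle by lia.
    split; [exact (Htr _ _ _ Hle (Hd i))|].
    apply not_true_is_false; intro Hij'.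
    apply (proj2 (Hs0 i)), Hanti; [apply Hd|exact (Htr _ _ _ Hij' Hle)]. }
  assert (Hbad : bad R s0).
  { split; [|intros i j Hij; apply (Hdec i j Hij)].
    intro i; apply (Hund _ _ (proj1 (Hs0 i))). }
  assert (Hnw : ~ well_quasi_order R).
  { intros [_ Hw]; destruct (Hw s0 (proj1 Hbad)) as (i & j & Hij & E).
    rewrite (proj2 Hbad i j Hij) in E; discriminate. }
  exists p, R; repeat apply conj; [apply computes_oracle|exact Hp| |].
  - exists s0; exact (conj (proj1 (proj1 HR)) (conj Hnw Hbad)).
  - intros r v Hr (_ & _ & Hu & Hb); exists r, v.
    split; [|split; [exact Hr|refine (conj HR (conj Hill _))]].
    + intro n; specialize (Ho (join p r) n); cbn beta in Ho; rewrite odds_join in Ho; exact Ho.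
    + intro i; assert (Hi := Hb i (S i) (Nat.lt_succ_diag_r i)); split.
      * destruct (Htot _ _ (Hu i) (Hu (S i))) as [E|E]; [congruence|exact E].
      * intro E; rewrite E in Hi; specialize (Hu i); unfold underlying in Hu; congruence.
Qed.

(** Goodness of [n]. One later recurrence of each [m >= n] suffices, since it can be iterated; this
    gives the for-all-exists form used below. *)
Definition recurrent_from (p : nat -> nat) (n : nat) : Prop :=
  forall m, n <= m -> exists m', m < m' /\ p m' = p m.

Lemma recurrent_from_le p n n' : n <= n' -> recurrent_from p n -> recurrent_from p n'.
Proof. intros Hn H m Hm; apply H; lia. Qed.

(** Each colour that dies out has a bound on its uses, and there are only [k] colours. *)
Lemma recurrent_from_exists p k : (forall n, p n < k) -> exists n, recurrent_from p n.
Proof.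
  intro Hp.
  destruct (uniform_bound (fun i N =>
    forall m, N <= m -> p m = i -> exists m', m < m' /\ p m' = p m) k) as [N HN].
  - intros i N M HN HNM m Hm; apply HN; lia.
  - intros i _.
    destruct (classic (exists N, forall m, N <= m -> p m <> i)) as [[N HN]|Hinf].
    + exists N; intros m Hm E; contradiction (HN m Hm E).
    + exists 0; intros m _ E; apply NNPP; intro Hn; apply Hinf; exists (S m).
      intros m' Hm' E'; apply Hn; exists m'; split; [exact Hm'|congruence].
  - exists N; intros m Hm; apply (HN (p m)); auto.
Qed.

Lemma recurrent_from_infinite p n :
  recurrent_from p n -> forall m, exists m', m <= m' /\ p m' = p n.
Proof.
  intros H m; assert (H' : exists m', m <= m' /\ n <= m' /\ p m' = p n).
  { induction m as [|m (m' & Hm & Hn & E)]; [exists n; auto with arith|].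
    destruct (H m' Hn) as (m2 & H2 & E2); exists m2; repeat split; [lia|lia|congruence]. }
  destruct H' as (m' & ? & _ & ?); eauto.
Qed.

Lemma least_witness (P : nat -> Prop) :
  (exists n, P n) -> exists n, P n /\ forall m, P m -> n <= m.
Proof.
  intro HP; destruct (dec_inh_nat_subset_has_unique_least_element P
    (fun n => classic (P n)) HP) as (n & Hn & _); eauto.
Qed.

Definition recurs (p : baire) (m t : nat) : bool :=
  existsb (fun i => (m <? i) && (p i =? p m)) (seq 0 t).

Lemma recurs_iff p m t : recurs p m t = true <-> exists i, m < i < t /\ p i = p m.
Proof.
  unfold recurs; rewrite existsb_exists; split.
  - intros (i & Hi & E); apply in_seq in Hi; apply andb_true_iff in E.
    rewrite Nat.ltb_lt, Nat.eqb_eq in E; exists i; split; [lia|apply E].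
  - intros (i & Hi & E); exists i; rewrite in_seq, andb_true_iff, Nat.ltb_lt, Nat.eqb_eq.
    repeat split; auto; lia.
Qed.

(** Some [m >= n] recurs for the first time at [t], when all of [n, ..., m]
    have recurred; for fixed [n] there are infinitely many such [t] exactly if
    every colour used from [n] on is used infinitely often. *)
Definition block (p : baire) (n t : nat) : bool :=
  existsb (fun m => (n <=? m) && negb (recurs p m t) &&
    forallb (fun i => (i <? n) || recurs p i (S t)) (seq 0 (S m))) (seq 0 t).

Lemma block_iff p n t : block p n t = true <->
  exists m, n <= m < t /\ recurs p m t = false /\
    forall i, n <= i <= m -> recurs p i (S t) = true.
Proof.
  unfold block; rewrite existsb_exists; split.
  - intros (m & Hm & E); apply in_seq in Hm.
    rewrite !andb_true_iff, Nat.leb_le, negb_true_iff, forallb_forall in E.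
    destruct E as [[Hn Hr] Hi]; exists m; repeat split; [lia|lia|exact Hr|].
    intros i Hi'; specialize (Hi i ltac:(apply in_seq; lia)).
    apply orb_true_iff in Hi; rewrite Nat.ltb_lt in Hi; destruct Hi; [lia|assumption].
  - intros (m & Hm & Hr & Hi); exists m; rewrite in_seq; split; [lia|].
    rewrite !andb_true_iff, Nat.leb_le, negb_true_iff, forallb_forall.
    repeat split; [lia|exact Hr|]; intros i Hi'; apply in_seq in Hi'.
    apply orb_true_iff; rewrite Nat.ltb_lt.
    destruct (Nat.lt_ge_cases i n); [auto|right; apply Hi; lia].
Qed.

(** Take the least [t] by which all of [n, ..., n + b] have recurred. By minimality one of them
    recurs first exactly at [t], and [t] exceeds [n + b] because [n + b] recurs only later. *)
Lemma block_infinite p n : recurrent_from p n -> infinite (block p n).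
Proof.
  intros H b.
  destruct (least_witness (fun t => forall i, n <= i <= n + b -> recurs p i (S t) = true))
    as (t & Ht & Hmin).
  { destruct (uniform_bound (fun i t => n <= i -> recurs p i (S t) = true) (S (n + b)))
      as [t Ht].
    - intros i t t' Hi Htt Hn; specialize (Hi Hn); apply recurs_iff in Hi.
      destruct Hi as (j & Hj & E); apply recurs_iff; exists j; split; [lia|exact E].
    - intros i _; destruct (Nat.le_gt_cases n i) as [Hn|Hn]; [|exists 0; lia].
      destruct (H i Hn) as (j & Hj & E); exists j; intros _.
      apply recurs_iff; exists j; split; [lia|exact E].
    - exists t; intros i Hi; apply Ht; lia. }
  assert (Hbt : n + b < t).
  { specialize (Ht (n + b) ltac:(lia)); apply recurs_iff in Ht; destruct Ht as (i & ? & _); lia. }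
  exists t; split; [lia|]; apply block_iff; apply NNPP; intro Hn.
  assert (Hall : forall i, n <= i <= n + b -> recurs p i t = true).
  { intros i Hi; apply not_false_is_true; intro E; apply Hn; exists i.
    repeat split; [lia|lia|exact E|intros j Hj; apply Ht; lia]. }
  specialize (Hmin (Nat.pred t)); replace (S (Nat.pred t)) with t in Hmin by lia.
  specialize (Hmin Hall); lia.
Qed.

(** If [m0] never recurs, only an [m] below [m0] can witness membership in the block. Each such [m]
    has at most one first recurrence, so the block is bounded. *)
Lemma block_recurrent p n : infinite (block p n) -> recurrent_from p n.
Proof.
  intros H m0 Hm0; apply NNPP; intro Hn.
  destruct (uniform_bound (fun m b => forall t, m < t -> recurs p m t = false ->
    recurs p m (S t) = true -> t <= b) m0) as [b Hb].
  - intros m b b' Hm Hbb t H1 H2 H3; specialize (Hm t H1 H2 H3); lia.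
  - intros m _.
    destruct (classic (exists t, m < t /\ recurs p m t = false /\ recurs p m (S t) = true))
      as [(t & Ht & E1 & E2)|Hno]; [exists t|exists 0; intros; exfalso; eauto].
    intros t' Ht' E1' E2'; apply Nat.le_ngt; intro Hlt.
    apply not_true_iff_false in E1'; apply E1', recurs_iff.
    apply recurs_iff in E2; destruct E2 as (i & Hi & E); exists i; split; [lia|exact E].
  - destruct (H (S b)) as (t & Ht & E); apply block_iff in E.
    destruct E as (m & Hm & E1 & E2).
    destruct (Nat.lt_ge_cases m m0) as [Hlt|Hge].
    + specialize (Hb m Hlt t ltac:(lia) E1 (E2 m ltac:(lia))); lia.
    + specialize (E2 m0 ltac:(lia)); apply recurs_iff in E2.
      destruct E2 as (i & Hi & E); apply Hn; exists i; split; [lia|exact E].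
Qed.

(** The ordinal sum over [n] of the sets [block p n] in reverse order. *)
Definition block_order (p : baire) (a b : nat) : bool :=
  block p (pi1 a) (pi2 a) && block p (pi1 b) (pi2 b) &&
  ((pi1 a <? pi1 b) || (pi1 a =? pi1 b) && (pi2 b <=? pi2 a)).

Lemma block_order_iff p a b : block_order p a b = true <->
  block p (pi1 a) (pi2 a) = true /\ block p (pi1 b) (pi2 b) = true /\
  (pi1 a < pi1 b \/ pi1 a = pi1 b /\ pi2 b <= pi2 a).
Proof.
  unfold block_order.
  rewrite !andb_true_iff, orb_true_iff, andb_true_iff, Nat.ltb_lt, Nat.eqb_eq, Nat.leb_le; tauto.
Qed.

Lemma pi_inj a b : pi1 a = pi1 b -> pi2 a = pi2 b -> a = b.
Proof. intros E1 E2; rewrite <- (pr_pi a), <- (pr_pi b), E1, E2; reflexivity. Qed.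

Lemma computable_block_order : computable (fun p z => Nat.b2n (block_order p (pi1 z) (pi2 z))).
Proof. unfold block_order, block, recurs; computable. Qed.

Lemma block_order_linear p : linear_order (fun z => block_order p (fst z) (snd z)).
Proof.
  unfold linear_order, partial_order, quasi_order, underlying; cbn [fst snd].
  setoid_rewrite block_order_iff; repeat apply conj.
  - intros x y H; split; intuition.
  - intros x y z (Hx & _ & Hxy) (_ & Hz & Hyz); repeat split; [exact Hx|exact Hz|lia].
  - intros x y (_ & _ & Hxy) (_ & _ & Hyx); apply pi_inj; lia.
  - intros x y (Hx & _) (Hy & _).
    destruct (lt_eq_lt_dec (pi1 x) (pi1 y)) as [[?|?]|?]; [tauto| |tauto].
    destruct (Nat.le_ge_cases (pi2 x) (pi2 y)); intuition.
Qed.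

(** Along a descending sequence the block index never increases, so it settles at some [v], where
    the second components grow. Hence block [v] is infinite and [v] is good; the first block index
    is at least [v], so it is good too, and reading one term suffices. *)
Lemma crt_le_DS k : crt k <=W DS.
Proof.
  assert (HP : computable (fun o _ => evens o (pi1 (odds o 0)))) by computable.
  destruct computable_block_order as [cb Hb], HP as [cp Hc].
  exists cb, cp; intros p c Hp _.
  assert (Hlt : forall n, p n < k) by (intro n; rewrite (Hp n); apply (proj2_sig (c n))).
  destruct (recurrent_from_exists p k Hlt) as [n Hn].
  set (R := (fun z => block_order p (fst z) (snd z)) : nat * nat -> bool).
  assert (Hill : ill_founded R).
  { destruct (infinite_enum _ (block_infinite _ _ Hn)) as (h & Hh & Hmon).
    exists (fun i => pr n (h i)); intro i.
    specialize (Hmon i (S i) (Nat.lt_succ_diag_r i)); split.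
    - apply block_order_iff; cbn [fst snd]; rewrite !pi1_pr, !pi2_pr; auto with arith.
    - intro E; apply (f_equal pi2) in E; rewrite !pi2_pr in E; lia. }
  assert (Hlin : linear_order R) by apply block_order_linear.
  exists (fun z => Nat.b2n (block_order p (pi1 z) (pi2 z))), R; repeat split.
  - apply Hb.
  - intros [a b]; change (to_nat (a, b)) with (pr a b); rewrite pi1_pr, pi2_pr; reflexivity.
  - destruct Hill as [s Hs]; exists s; exact (conj Hlin (conj (ex_intro _ s Hs) Hs)).
  - intros r s Hr (_ & _ & Hs).
    assert (Hd : forall i, block p (pi1 (s i)) (pi2 (s i)) = true /\
      (pi1 (s (S i)) < pi1 (s i) \/
       pi1 (s (S i)) = pi1 (s i) /\ pi2 (s i) < pi2 (s (S i)))).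
    { intro i; destruct (Hs i) as [E N]; apply block_order_iff in E; cbn [fst snd] in E.
      destruct E as (_ & E & [H|[H1 H2]]); [auto|split; [exact E|right; split; [exact H1|]]].
      destruct (Nat.eq_dec (pi2 (s i)) (pi2 (s (S i)))); [|lia].
      contradiction N; apply pi_inj; congruence. }
    (* The settled index is the least one attained. *)
    destruct (least_witness (fun v => exists i, pi1 (s i) = v)) as (v & [i0 Hi0] & Hv);
      [exists (pi1 (s 0)), 0; reflexivity|].
    assert (Hconst : forall j, pi1 (s (j + i0)) = v).
    { induction j as [|j IH]; [exact Hi0|].
      specialize (Hv (pi1 (s (S j + i0))) (ex_intro _ _ eq_refl)).
      specialize (Hd (j + i0)); cbn [plus] in *; lia. }
    assert (Hgrow : forall j, j <= pi2 (s (j + i0))).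
    { induction j as [|j IH]; [lia|].
      destruct (Hd (j + i0)) as [_ H]; pose proof (Hconst j); pose proof (Hconst (S j)).
      cbn [plus] in *; lia. }
    assert (Hrec : recurrent_from p (pi1 (s 0))).
    { apply recurrent_from_le with v; [apply Hv; eauto|].
      apply block_recurrent; intro m; exists (pi2 (s (m + i0))); split; [apply Hgrow|].
      rewrite <- (Hconst m); apply Hd. }
    exists (fun _ => p (pi1 (r 0))), (c (pi1 (s 0))); repeat split.
    + intro x; specialize (Hc (join p r) x); cbn beta in Hc.
      rewrite evens_join, odds_join in Hc; exact Hc.
    + rewrite (Hr 0); apply Hp.
    + intro m; destruct (recurrent_from_infinite _ _ Hrec m) as (m' & Hm & E).
      exists m'; split; [exact Hm|apply colour_eq].
      rewrite <- (Hp m'), E; apply Hp.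
Qed.

(** On [(n, s)]: [s] is a partial Skolem function for [recurrent_from p n]. *)
Definition witness_tree (p : baire) (x : nat) : bool :=
  forallb (fun m => (drop_code (pi2 x) m =? 0) || (m <? pi1 x) ||
    (m <? item (pi2 x) m) && (p (item (pi2 x) m) =? p m)) (seq 0 (pi2 x)).

Lemma computable_witness_tree : computable (fun p x => Nat.b2n (witness_tree p x)).
Proof.
  unfold witness_tree.
  repeat (computable; try first [apply computable_drop_code|apply computable_item]).
Qed.

Lemma length_le_enc_list s : length s <= enc_list s.
Proof.
  induction s as [|x s IH]; cbn [length enc_list]; [lia|].
  pose proof (to_nat_non_decreasing x (enc_list s)); lia.
Qed.

(** The program lets [m] range below the code of [s], which bounds the length; past the end of [s]
    the dropped code is 0 and the test is vacuous. *)
Lemma witness_tree_iff p n s : witness_tree p (enc_node (n, s)) = true <->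
  forall m, n <= m < length s -> m < nth m s 0 /\ p (nth m s 0) = p m.
Proof.
  unfold witness_tree, enc_node; cbn [fst snd]; change (to_nat (n, enc_list s)) with (pr n (enc_list s)).
  rewrite pi1_pr, pi2_pr, forallb_forall; split.
  - intros H m Hm; specialize (H m).
    pose proof (length_le_enc_list s).
    rewrite in_seq, !orb_true_iff, andb_true_iff, !Nat.ltb_lt, !Nat.eqb_eq, item_enc_list,
      drop_code_enc_list in H.
    destruct H as [[H|H]|H]; [lia| |lia|exact H].
    destruct (skipn m s) eqn:E; [|discriminate].
    apply (f_equal (@length nat)) in E; rewrite length_skipn in E; cbn in E; lia.
  - intros H m _; specialize (H m).
    rewrite !orb_true_iff, andb_true_iff, !Nat.ltb_lt, !Nat.eqb_eq, item_enc_list,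
      drop_code_enc_list.
    destruct (Nat.lt_ge_cases m n); [auto|].
    destruct (Nat.lt_ge_cases m (length s)); [auto|].
    rewrite skipn_all2 by assumption; auto.
Qed.

(** An infinite path is a full Skolem function. Conversely one is found by search, with arbitrary
    values below [n]. *)
Lemma has_path_witness_tree p n :
  has_path (fun s => witness_tree p (enc_node (n, s))) <-> recurrent_from p n.
Proof.
  split.
  - intros [g Hg] m Hm; specialize (Hg (S m)); rewrite witness_tree_iff in Hg.
    specialize (Hg m); rewrite length_map, length_seq, nth_map_seq in Hg by lia.
    exists (g m); apply Hg; lia.
  - intro H.
    assert (next : forall m, { v | n <= m -> m < v /\ p v = p m }).
    { intro m; apply constructive_indefinite_ground_description_nat.
      - intro v; destruct (le_dec n m), (lt_dec m v), (Nat.eq_dec (p v) (p m)); tauto.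
      - destruct (le_dec n m) as [Hm|Hm]; [destruct (H m Hm) as [v Hv]; eauto|].
        exists 0; tauto. }
    exists (fun m => proj1_sig (next m)); intro l; apply witness_tree_iff; intros m Hm.
    rewrite length_map, length_seq in Hm; rewrite nth_map_seq by lia.
    apply (proj2_sig (next m)); lia.
Qed.

(** The partial order is the usual one on the natural numbers and the dense set consists of the good
    numbers, so the colour at any solution recurs infinitely often. *)
Lemma crt_le_SDDCC k : crt k <=W SDDCC.
Proof.
  assert (HL : computable (fun _ z => Nat.b2n (pi1 z <=? pi2 z))) by computable.
  assert (HP : computable (fun o _ => evens o (odds o 0))) by computable.
  destruct HL as [cl Hl], HP as [cp Hc], computable_witness_tree as [ct Ht].
  destruct (computes_join cl ct) as [cj Hj].
  exists cj, cp; intros p c Hp _.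
  assert (Hlt : forall n, p n < k) by (intro n; rewrite (Hp n); apply (proj2_sig (c n))).
  destruct (recurrent_from_exists p k Hlt) as [n Hn].
  set (R := (fun z => fst z <=? snd z) : nat * nat -> bool).
  set (T := (fun x => witness_tree p (enc_node x)) : nat * list nat -> bool).
  assert (HT : forall a, coded T a <-> recurrent_from p a) by (intro; apply has_path_witness_tree).
  assert (HR : forall a b, R (a, b) = true <-> a <= b) by (intros; apply Nat.leb_le).
  assert (Hsol : forall a : nat, coded T a -> solution SDDCC (R, T) a).
  { intros a Ha; refine (conj _ (conj _ (conj _ (conj _ (conj _ Ha))))); cbn [fst snd].
    - unfold partial_order, quasi_order, underlying; setoid_rewrite HR; repeat apply conj; intros; lia.
    - intros m s t; unfold T; rewrite !witness_tree_iff, length_app; intros H i Hi.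
      specialize (H i); rewrite app_nth1 in H by lia; apply H; lia.
    - intros m _; apply HR, le_n.
    (* Goodness of [n] passes to [n + w], which also lies above [w]. *)
    - intros w _; exists (n + w); split; [apply HR; lia|].
      apply HT; revert Hn; apply recurrent_from_le; lia.
    - intros w u Hw Hwu; apply HR in Hwu; apply HT; apply HT in Hw.
      exact (recurrent_from_le _ _ _ Hwu Hw). }
  exists (join (fun z => Nat.b2n (pi1 z <=? pi2 z)) (fun x => Nat.b2n (witness_tree p x))), (R, T).
  repeat split.
  - apply Hj; [apply (Hl p)|apply Ht].
  - rewrite evens_join; intros [a b]; change (to_nat (a, b)) with (pr a b).
    rewrite pi1_pr, pi2_pr; reflexivity.
  - rewrite odds_join; intro x; reflexivity.
  - exists n; apply Hsol, HT, Hn.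
  - intros r a Hr (_ & _ & _ & _ & _ & Ha); apply HT in Ha.
    exists (fun _ => p (r 0)), (c a); repeat split.
    + intro x; specialize (Hc (join p r) x); cbn beta in Hc.
      rewrite evens_join, odds_join in Hc; exact Hc.
    + cbn in Hr; rewrite Hr; apply Hp.
    + intro m; destruct (recurrent_from_infinite _ _ Ha m) as (m' & Hm & E).
      exists m'; split; [exact Hm|apply colour_eq].
      rewrite <- (Hp m'), E; apply Hp.
Qed.

(** By maximality any two representatives for one problem are equivalent, so [C] links [F] to
    [F']. *)
Lemma is_Fin_unique k f g (F F' C : fin_problem k) :
  is_Fin f C -> is_Fin g C -> is_Fin f F -> is_Fin g F' -> F =W F'.
Proof.
  intros [C1 C2] [C3 C4] [F1 F2] [F3 F4]; split; apply weihrauch_le_trans with C; auto.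
Qed.

Theorem theorem5p3 (k : nat) (hk : 0 < k) :
  (exists F_BS : fin_problem k, is_Fin BS F_BS) /\
  (exists F_SDDCC : fin_problem k, is_Fin SDDCC F_SDDCC) /\
  (exists F_DS : fin_problem k, is_Fin DS F_DS) /\
  (forall F_BS F_SDDCC F_DS : fin_problem k,
     is_Fin BS F_BS -> is_Fin SDDCC F_SDDCC -> is_Fin DS F_DS ->
     F_BS =W F_SDDCC /\ F_SDDCC =W F_DS /\ F_DS =W RT1 k).
Proof.
  assert (HDS : is_Fin DS (crt k)).
  { split; [apply crt_le_DS|]; intros G HG.
    apply fin_le_BS; [exact hk|apply weihrauch_le_trans with DS; auto using DS_le_BS]. }
  assert (HBS : is_Fin BS (crt k)).
  { split; [apply weihrauch_le_trans with DS; auto using crt_le_DS, DS_le_BS|].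
    intros G; apply fin_le_BS, hk. }
  assert (HSD : is_Fin SDDCC (crt k)).
  { split; [apply crt_le_SDDCC|]; intros G; apply fin_le_SDDCC, hk. }
  repeat apply conj; [eauto|eauto|eauto|].
  intros F1 F2 F3 H1 H2 H3; split; [|split].
  - exact (is_Fin_unique _ _ _ _ _ _ HBS HSD H1 H2).
  - exact (is_Fin_unique _ _ _ _ _ _ HSD HDS H2 H3).
  (* [RT1 k] does not have finite codomain, so it is compared with [F3] through [crt k]. *)
  - destruct HDS as [D1 D2], H3 as [E1 E2]; split.
    + apply weihrauch_le_trans with (crt k); auto using crt_le_RT1.
    + apply weihrauch_le_trans with (crt k); auto using RT1_le_crt.
Qed.
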